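(* Let $X$ be a Banach space and let $\xi\geq 1$ be a countable ordinal. Then the partially ordered set $\mathbf{SM}_\xi^w(X)$ is an upper semi-lattice, i.e. every two elements of $\mathbf{SM}_\xi^w(X)$ have a least upper bound in $\mathbf{SM}_\xi^w(X)$ with respect to $\preccurlyeq$.
   Context: Notation. $\mathbb{N}=\{1,2,\dots\}$. For $M\subseteq\mathbb N$, $[M]^{\infty}$ and $[M]^{<\infty}$ denote the sets of infinite and of finite subsets of $M$. For an infinite (resp. finite) set $L\subseteq\mathbb N$, $L(k)$ is the $k$-th element of $L$ in increasing order; $|s|$ is the cardinality of $s$. Regular thin families. A family $\mathcal R$ of finite subsets of $\mathbb N$ is regular if it is compact (the characteristic functions of its members form a compact subset of $\{0,1\}^{\mathbb N}$ with the product topology), hereditary (it contains all subsets of its members) and spreading (if $s\in\mathcal R$, $t\in[\mathbb N]^{<\infty}$, $|s|=|t|=n$ and $s(i)\leq t(i)$ for $1\leq i\leq n$, then $t\in\mathcal R$). A family $\mathcal F$ is regular thin if it is the set of inclusion-maximal elements of some regular family $\mathcal R$. The order of $\mathcal R$ is $o(\mathcal R)=\rho(\emptyset)$, where $\rho(t)=\sup\{\rho(s)+1: s\in\mathcal R,\ t\subsetneq s\}$ (with $\sup\emptyset=0$), a countable ordinal; and $o(\mathcal F)=o(\mathcal R)$. Put $\mathcal F\upharpoonright L=\{s\in\mathcal F:s\subseteq L\}$, $\widehat{\mathcal F}=\{s: s\subseteq t\text{ for some }t\in\mathcal F\}$, $\widehat{\mathcal F}\upharpoonright L=\{s\in\widehat{\mathcal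 F}:s\subseteq L\}$; the latter has the subspace topology of $\{0,1\}^{\mathbb N}$ (sets identified with characteristic functions). Plegma families. An $l$-tuple $(s_j)_{j=1}^l$ of nonempty finite subsets of $\mathbb N$ is plegma if (i) $s_i(k)<s_j(k)$ whenever $1\leq i<j\leq l$ and $1\leq k\leq\min(|s_i|,|s_j|)$, and (ii) $s_i(k)<s_j(k+1)$ for all $i,j\in\{1,\dots,l\}$ and $1\leq k\leq\min(|s_i|,|s_j|-1)$. $\mathrm{Plm}_k(\mathcal F\upharpoonright L)$ is the set of plegma $k$-tuples of members of $\mathcal F\upharpoonright L$. Spreading models. An $\mathcal F$-sequence in $X$ is a family $(x_s)_{s\in\mathcal F}$ in $X$; an $\mathcal F$-subsequence is $(x_s)_{s\in\mathcal F\upharpoonright L}$ with $L\in[\mathbb N]^\infty$. Let $(e_n)_n$ be a Hamel basis of an infinite-dimensional seminormed space $(E,\|\cdot\|_* )$. $(x_s)_{s\in\mathcal F\upharpoonright M}$ generates $(e_n)_n$ as an $\mathcal F$-spreading model if there is a null sequence $(\delta_n)_n$ of positive reals such that for all $1\leq k\leq l$, all $a_1,\dots,a_k\in[-1,1]$ and all $(s_j)_{j=1}^k\in\mathrm{Plm}_k(\mathcal F\upharpoonright M)$ with $s_1(1)\geq M(l)$, $\big|\,\|\sum_{j=1}^k a_jx_{s_j}\|-\|\sum_{j=1}^k a_je_j\|_*\big|\leq\delta_l$. $(x_s)_{s\in\mathcal F\upharpoonright L}$ is subordinated if there is a map $\widehat\varphi:\widehat{\mathcal F}\upharpoonright L\to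 X$, continuous for the weak topology of $X$, with $\widehat\varphi(s)=x_s$ for all $s\in\mathcal F\upharpoonright L$. It is weakly null if for every $x^*\in X^*$ and $\varepsilon>0$ there is $n_0$ such that $|x^*(x_s)|<\varepsilon$ for every $s\in\mathcal F\upharpoonright L$ with $\min s\geq n_0$. $SM_\xi^w(X)$ is the set of all sequences $(e_n)_n$ generated as an $\mathcal F$-spreading model by some subordinated weakly null $\mathcal F$-subsequence in $X$, for some regular thin family $\mathcal F$ of order $\xi$. Order. For $(e_n^1)_n,(e_n^2)_n$, write $(e^1_n)_n\preccurlyeq(e^2_n)_n$ if there is $C>0$ with $\|\sum_{i=1}^n a_ie_i^1\|\leq C\|\sum_{i=1}^n a_ie_i^2\|$ for all $n\in\mathbb N$ and all reals $a_1,\dots,a_n$ (each norm being the respective seminorm); write $(e_n^1)_n\sim(e_n^2)_n$ if both $(e^1_n)_n\preccurlyeq(e^2_n)_n$ and $(e^2_n)_n\preccurlyeq(e^1_n)_n$. $\mathbf{SM}_\xi^w(X)=SM_\xi^w(X)/\!\sim$, with the partial order induced by $\preccurlyeq$. *)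

(* Defs.v *)
(* MathComp / MathComp-Analysis *)
From HB Require Import structures.
From mathcomp Require Import all_boot all_order all_algebra finmap.
From mathcomp Require Import all_classical all_reals all_analysis.

Set Implicit Arguments.
Unset Strict Implicit.
Unset Printing Implicit Defensive.

Import Order.TTheory GRing.Theory Num.Theory.
Import numFieldNormedType.Exports.

Local Open Scope classical_set_scope.
Local Open Scope ring_scope.

(* Indexing: {1, 2, ...} is replaced by the order-isomorphic [nat], and the    *)
(* k-th element of a set, the k-th vector of a sequence and the k-th member of *)
(* a tuple carry the index k - 1.                                              *)

(* [OSup D f] is the ordinal sup {f i + 1 : i in D}.  As the index types are   *)
(* countable, the inhabitants denote exactly the countable ordinals; an        *)
(* ordinal has many representations, so that [ord_eq] is used as equality.     *)
Inductive countable_ord : Type :=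
  OSup (I : countType) (D : set I) (f : I -> countable_ord).

(* sup_i (f i + 1) <= sup_j (g j + 1) iff each f i is at most some g j. *)
Fixpoint ord_le (x y : countable_ord) {struct x} : Prop :=
  match x, y with
  | OSup _ D f, OSup _ E g =>
      forall i, D i -> exists2 j, E j & ord_le (f i) (g j)
  end.

Definition ord_eq (x y : countable_ord) : Prop := ord_le x y /\ ord_le y x.

Definition ord0c : countable_ord := OSup set0 (fun i : void => match i with end).

Definition ord1c : countable_ord := OSup [set: unit] (fun=> ord0c).

Section families.
Implicit Types (s t : {fset nat}) (F R : set {fset nat}) (L M : set nat).

Definition fkth s (k : nat) : nat := nth 0%N (sort leq s) k.

(* The element of L that has exactly k predecessors in L. *)
Definition kth L (k : nat) : nat :=
  xget 0%N [set m | L m /\ count (fun i => i \in L) (iota 0 m) = k].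

Definition charf s : cantor_space := fun n => n \in s.

Definition hereditary R : Prop :=
  forall s t, R t -> (s `<=` t)%fset -> R s.

Definition spreading R : Prop :=
  forall s t, R s -> #|` s| = #|` t| ->
    (forall i, (i < #|` s|)%N -> (fkth s i <= fkth t i)%N) -> R t.

Definition regular R : Prop :=
  [/\ compact (charf @` R), hereditary R & spreading R].

Definition maximal_elements R : set {fset nat} :=
  [set s | R s /\ forall t, R t -> (s `<=` t)%fset -> t = s].

Definition family_order R (xi : countable_ord) : Prop :=
  exists2 rho : {fset nat} -> countable_ord,
    forall t, ord_eq (rho t) (OSup [set s | R s /\ (t `<` s)%fset] rho)
    & ord_eq (rho fset0) xi.

Definition regular_thin_of_order F (xi : countable_ord) : Prop :=
  exists R, [/\ regular R, F = maximal_elements R & family_order R xi].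

Definition restr F L : set {fset nat} := [set s | F s /\ [set` s] `<=` L].

Definition hat F : set {fset nat} :=
  [set s | exists2 t, F t & (s `<=` t)%fset].

Definition plegma (l : nat) (s : 'I_l -> {fset nat}) : Prop :=
  [/\ forall i, s i != fset0,
      forall (i j : 'I_l) (k : nat), (i < j)%N ->
        (k < minn #|` s i| #|` s j|)%N -> (fkth (s i) k < fkth (s j) k)%N
    & forall (i j : 'I_l) (k : nat),
        (k < minn #|` s i| (#|` s j|).-1)%N ->
        (fkth (s i) k < fkth (s j) k.+1)%N].

Definition Plm (k : nat) F : set ('I_k -> {fset nat}) :=
  [set s | plegma s /\ forall i, F (s i)].

End families.

Arguments Plm k F : clear implicits.

Section weak_topology.
Context {R : realType} (X : normedModType R).

Definition dual : Type := {f : {scalar X} | continuous (f : X -> R)}.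

(* The coarsest topology on X making every element of the dual continuous. *)
Definition weak_space : Type :=
  sup_topology (fun f : dual =>
    Topological.class (initial_topology (sval f : X -> R))).

HB.instance Definition _ := Topological.on weak_space.

End weak_topology.

(* A sequence (e_n) forming a Hamel basis of a seminormed space; such a space  *)
(* is automatically infinite dimensional.                                      *)
Record hamel_seq (R : realType) := HamelSeq {
  hs_space : lmodType R;
  hs_norm : hs_space -> R;
  hs_vec : nat -> hs_space;
  hs_normD : forall x y, hs_norm (x + y) <= hs_norm x + hs_norm y;
  hs_normZ : forall (a : R) x, hs_norm (a *: x) = `|a| * hs_norm x;
  hs_free : forall n (a : 'I_n -> R),
    \sum_(i < n) a i *: hs_vec i = 0 -> forall i, a i = 0;
  hs_span : forall x, exists n (a : 'I_n -> R),
    x = \sum_(i < n) a i *: hs_vec i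
}.

(* The seminorm of a_1 e_1 + ... + a_n e_n. *)
Definition comb_norm (R : realType) (e : hamel_seq R) (n : nat)
    (a : 'I_n -> R) : R :=
  hs_norm (\sum_(i < n) a i *: hs_vec e i).

Definition dominated (R : realType) (e1 e2 : hamel_seq R) : Prop :=
  exists2 C : R, 0 < C &
    forall n (a : 'I_n -> R), comb_norm e1 a <= C * comb_norm e2 a.

Definition seq_equiv (R : realType) (e1 e2 : hamel_seq R) : Prop :=
  dominated e1 e2 /\ dominated e2 e1.

(* An F-sequence is given by a total map x on finite sets, of which only the   *)
(* values on the members of F (or of its restriction to L) are relevant.       *)
Section spreading_models.
Context {R : realType} (X : completeNormedModType R).
Implicit Types (F : set {fset nat}) (L M : set nat) (x : {fset nat} -> X).

Definition generates F M x (e : hamel_seq R) : Prop :=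
  exists delta : nat -> R,
    [/\ forall n, 0 < delta n,
        delta @ \oo --> (0 : R)
      & forall (k l : nat) (a : 'I_k.+1 -> R) (s : 'I_k.+1 -> {fset nat}),
          (k.+1 <= l)%N ->
          (forall j, `|a j| <= 1) ->
          Plm k.+1 (restr F M) s ->
          (kth M l.-1 <= fkth (s ord0) 0)%N ->
          `| `|\sum_(j < k.+1) a j *: x (s j)| - comb_norm e a | <= delta l].

Definition subordinated F L x : Prop :=
  exists2 phi : cantor_space -> weak_space X,
    {within charf @` restr (hat F) L, continuous phi}
    & forall s, restr F L s -> phi (charf s) = x s.

Definition weakly_null F L x : Prop :=
  forall (f : dual X) (eps : R), 0 < eps ->
    exists n0 : nat, forall s, restr F L s ->
      (n0 <= fkth s 0)%N -> `|sval f (x s)| < eps.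

(* From here on collections are plain predicates: [hamel_seq R] lives in a     *)
(* universe above the one allowed by [set].                                    *)
Definition SMw (xi : countable_ord) (e : hamel_seq R) : Prop :=
  exists F L x,
    [/\ regular_thin_of_order F xi, infinite_set L,
        subordinated F L x, weakly_null F L x & generates F L x e].

(* The quotient of [SMw xi] by [seq_equiv], as the collection of its classes. *)
Definition SMw_classes (xi : countable_ord) (C : hamel_seq R -> Prop) : Prop :=
  exists2 e, SMw xi e & C = (fun e' => SMw xi e' /\ seq_equiv e e').

End spreading_models.

Definition class_le (R : realType) (C D : hamel_seq R -> Prop) : Prop :=
  exists e f, [/\ C e, D f & dominated e f].

Definition partial_order_on (T : Type) (A : T -> Prop) (le : T -> T -> Prop) : Prop :=
  [/\ forall a, A a -> le a a,
      forall a b, A a -> A b -> le a b -> le b a -> a = b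
    & forall a b c, A a -> A b -> A c -> le a b -> le b c -> le a c].

Definition is_join (T : Type) (A : T -> Prop) (le : T -> T -> Prop) (a b c : T) : Prop :=
  [/\ A c, le a c, le b c
    & forall d, A d -> le a d -> le b d -> le c d].

Definition upper_semilattice (T : Type) (A : T -> Prop) (le : T -> T -> Prop) : Prop :=
  partial_order_on A le /\
  forall a b, A a -> A b -> exists c, is_join A le a b c.

(* Main.v *)
From HB Require Import structures.
Require Import Defs.
From mathcomp Require Import all_boot all_order all_algebra finmap.
From mathcomp Require Import all_classical all_reals all_analysis.
From mathcomp Require Import lra zify.

Set Implicit Arguments.
Unset Strict Implicit.
Unset Printing Implicit Defensive.

Import Order.TTheory GRing.Theory Num.Theory.
Import numFieldNormedType.Exports.

Local Open Scope classical_set_scope.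
Local Open Scope ring_scope.

(** Let e0 and e1 be generated by weakly null subordinated families x0 and x1,
indexed by the regular thin families F0 and F1 of the same order.  The join of
their classes is the class of a spreading model e of a family of the form
x_s = x0_(s0) + x1_(s1), where s0 and s1 are plegma-preserving functions of s,
and where s0 lies to the left of s1.  The triangle inequality bounds e by
e0 + e1, so e is below every common upper bound of e0 and e1.  What takes work
is that e exists and dominates both e0 and e1; for equal s0 and s1 the two
summands could cancel.

The tool for both is a nonprincipal ultrafilter U on nat.  After thinning, the
members of a regular family are the nodes of a well founded tree of increasing
sequences, the maximal members being its leaves ([pullback_tree]).  A plegma
tuple of leaves is built by a game: several players start at the roots of their
trees, and the one who is behind appends a number to his node, until all of
them have reached leaves ([turn]).  [almost J P s] says that P holds for the
final position when U-almost every number is chosen at every move.  On each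
such game this is an ultrafilter of final positions ([almost_em],
[almost_and]), and the games are compatible when players are added
([almost_proj], [almost_lift]).  Hence the norm of a combination of the vectors
x0_(t 2i) + x1_(t 2i+1), the players being 0, 1, 2 and so on, has a limit, and
these limits form the seminorm of e ([join_seq]).  A fusion argument
([game_fusion]) produces an infinite set all of whose plegma tuples are close to
the limit; this replaces the Ramsey theorem for plegma families.

Domination is Mazur's theorem ([game_mazur]).  Let a combination have norm at
most c for almost all positions, and play the game backwards.  When a player of
the other family moves, his vectors converge weakly to the vector of the current
node, so convex combinations of them converge in norm, and the norm of the
combination with that move undone is still at most c, up to eps.  At the end the
players of that family are back at their roots, where their vectors vanish, while
the players of the chosen family have moved to the end.  So the norm of the sum
dominates the norm of either part ([model_le_bounded]).

Since both families have order xi, their ranks can be compared with the rank of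
F0 ([embed_tree]): for a sufficiently sparse set of indices, each member of F0
over this set encodes a leaf of either tree, the first leaf met on its way
([part_leaf]).  The family indexed by F0 obtained in this way is subordinated and
weakly null, and it generates e. *)

(** * Sublinear functionals and the Mazur-Orlicz theorem *)

Section hahn_banach.
Context {R : realType} (X : lmodType R).
Implicit Types (p q : X -> R) (x y u : X) (c t : R).

Definition sublinear p : Prop :=
  (forall x y, p (x + y) <= p x + p y) /\
  (forall t x, 0 <= t -> p (t *: x) <= t * p x).

Lemma sublinear0 p : sublinear p -> p 0 = 0.
Proof.
move=> [pD pZ]; have := pZ 0 0 (lexx _); rewrite scale0r mul0r => p0.
by apply/eqP; rewrite eq_le p0 /=; have := pD 0 0; rewrite addr0; lra.
Qed.

Lemma sublinearN p x : sublinear p -> - p (- x) <= p x.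
Proof. by move=> sp; have := sp.1 x (- x); rewrite subrr sublinear0//; lra. Qed.

Definition convex_cone (C : X -> R -> Prop) : Prop :=
  [/\ C 0 0, (forall u v c d, C u c -> C v d -> C (u + v) (c + d))
    & forall t u c, 0 <= t -> C u c -> C (t *: u) (t * c)].

(** The perturbation of p that stays sublinear and that forces every functional
below it that is linear to be at least c at u, for each pair (u, c) of the cone. *)
Definition cone_inf p (C : X -> R -> Prop) (x : X) : R :=
  inf [set r | exists u c, C u c /\ r = p (x + u) - c].

Section cone_inf.
Variables (p : X -> R) (C : X -> R -> Prop).
Hypotheses (sp : sublinear p) (cC : convex_cone C).
Hypothesis Cp : forall u c, C u c -> c <= p u.

Lemma cone_inf_has_inf x :
  has_inf [set r | exists u c, C u c /\ r = p (x + u) - c].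
Proof.
have [C0 _ _] := cC; split; first by exists (p (x + 0) - 0), 0, 0.
exists (- p (- x)) => _ [u [c [/Cp cu ->]]].
by have := sp.1 (- x) (x + u); rewrite addKr; lra.
Qed.

Lemma cone_inf_le x u c : C u c -> cone_inf p C x <= p (x + u) - c.
Proof.
by move=> Cu; apply: ge_inf; [case: (cone_inf_has_inf x)|exists u, c].
Qed.

Lemma le_cone_inf x r :
  (forall u c, C u c -> r <= p (x + u) - c) -> r <= cone_inf p C x.
Proof.
move=> h; apply: lb_le_inf; first by case: (cone_inf_has_inf x).
by move=> _ [u [c [/h ? ->]]].
Qed.

Lemma cone_inf_sublinear : sublinear (cone_inf p C).
Proof.
have [C0 CD CZ] := cC; split=> [x y|t x].
  rewrite -lerBlDr; apply: le_cone_inf => u c Cu.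
  rewrite lerBlDr -lerBlDl; apply: le_cone_inf => v d Cv.
  have := cone_inf_le (x + y) (CD _ _ _ _ Cu Cv).
  by rewrite addrACA; have := sp.1 (x + u) (y + v); lra.
rewrite [0 <= t]le_eqVlt => /predU1P[<-|t0].
  rewrite scale0r mul0r; have := cone_inf_le 0 C0.
  by rewrite addr0 subr0 (sublinear0 sp).
rewrite mulrC -ler_pdivrMr//; apply: le_cone_inf => u c Cu.
rewrite ler_pdivrMr//; have := cone_inf_le (t *: x) (CZ _ _ _ (ltW t0) Cu).
rewrite -scalerDr; have := sp.2 t (x + u) (ltW t0); rewrite mulrBl.
by rewrite [X in _ -> _ -> _ <= X - _]mulrC [X in _ -> _ -> _ <= _ - X]mulrC; lra.
Qed.

Lemma cone_inf_le_self x : cone_inf p C x <= p x.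
Proof. by have [C0 _ _] := cC; have := cone_inf_le x C0; rewrite addr0 subr0. Qed.

Lemma cone_infN u c : C u c -> cone_inf p C (- u) <= - c.
Proof. by move=> /(cone_inf_le (- u)); rewrite addNr (sublinear0 sp) add0r. Qed.

End cone_inf.

(** Zorn: along a chain the pointwise infimum is sublinear, and it is finite because
every sublinear q below p satisfies q x >= - p (- x). *)
Lemma sublinear_minimal p : sublinear p ->
  exists q, [/\ sublinear q, forall x, q x <= p x &
    forall q', sublinear q' -> (forall x, q' x <= q x) -> q' = q].
Proof.
move=> sp; pose T := {q | sublinear q /\ forall x, q x <= p x}.
have p0 : T by exists p.
pose le (q q' : T) := `[< forall x, sval q' x <= sval q x >].
have [||A Atot|[q [sq qp]] qmin] := @ZL_preorder T p0 le.
- by move=> t; apply/asboolP.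
- by move=> r s t /asboolP sr /asboolP ts; apply/asboolP => x; exact: le_trans (ts x) (sr x).
- have [[q0 Aq0]|A0] := pselect (exists q : T, A q); last first.
    by exists p0 => s As; case: A0; exists s.
  pose V x := [set r | exists2 q : T, A q & r = sval q x].
  have hV x : has_inf (V x).
    split; first by exists (sval q0 x), q0.
    exists (- p (- x)) => _ [[q [sq qp]] _ -> /=].
    by have := sublinearN x sq; have := qp (- x); lra.
  pose m x := inf (V x).
  have mle x (q : T) : A q -> m x <= sval q x.
    by move=> Aq; apply: ge_inf; [case: (hV x)|exists q].
  have lem x r : (forall q : T, A q -> r <= sval q x) -> r <= m x.
    move=> h; apply: lb_le_inf; first by case: (hV x).
    by move=> _ [q /h ? ->].
  have sm : sublinear m.
    split=> [x y|t x].
      rewrite -lerBlDr; apply: (lem x) => q1 Aq1.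
      rewrite lerBlDr -lerBlDl; apply: (lem y) => q2 Aq2.
      have [q [Aq q12 q21]] : exists q : T, [/\ A q,
          forall z, sval q z <= sval q1 z & forall z, sval q z <= sval q2 z].
        by case: (Atot _ _ Aq1 Aq2) => /asboolP h; [exists q2|exists q1]; split.
      have := mle (x + y) _ Aq; have := (svalP q).1.1 x y.
      by have := q12 x; have := q21 y; lra.
    rewrite [0 <= t]le_eqVlt => /predU1P[<-|t0].
      rewrite scale0r mul0r; have := mle 0 _ Aq0.
      by rewrite (sublinear0 (svalP q0).1).
    rewrite mulrC -ler_pdivrMr//; apply: (lem x) => q Aq.
    rewrite ler_pdivrMr//; have := mle (t *: x) _ Aq.
    by have := (svalP q).1.2 t x (ltW t0); rewrite mulrC; lra.
  have mp : sublinear m /\ forall x, m x <= p x.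
    by split=> // x; apply: le_trans (mle x _ Aq0) _; exact: (svalP q0).2.
  by exists (exist _ m mp) => s As; apply/asboolP => x /=; exact: mle.
- exists q; split=> // q' sq' q'q; apply/funext => x; apply/eqP.
  have hq' : sublinear q' /\ forall x, q' x <= p x.
    by split=> // y; apply: le_trans (q'q y) (qp y).
  have /asboolP/(_ x)/= qq' : le (exist _ q' hq') (exist _ q (conj sq qp)).
    by apply: qmin; apply/asboolP.
  by rewrite eq_le q'q qq'.
Qed.

(** A minimal sublinear q below [cone_inf p C] is linear.  For fixed y, perturbing q
by the cone of the pairs (t y, t q(y)) gives a functional below q, which is q by
minimality; this means that q (x + y) - q y is at least q x. *)
Lemma mazur_orlicz p (C : X -> R -> Prop) : sublinear p -> convex_cone C ->
  (forall u c, C u c -> c <= p u) ->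
  exists f : {scalar X}, (forall x, f x <= p x) /\ forall u c, C u c -> c <= f u.
Proof.
move=> sp cC Cp.
have [q [sq qle qmin]] := sublinear_minimal (cone_inf_sublinear sp cC Cp).
have addq x y : q (x + y) = q x + q y.
  apply/eqP; rewrite eq_le sq.1 /=.
  (* Additivity is superadditivity, obtained from minimality against this ray. *)
pose D u c := exists2 t, 0 <= t & u = t *: y /\ c = t * q y.
  have cD : convex_cone D.
    split=> [|u v c d [s s0 [-> ->]] [t t0 [-> ->]]|s u c s0 [t t0 [-> ->]]].
    - by exists 0; rewrite // scale0r mul0r.
    - by exists (s + t); rewrite ?addr_ge0// scalerDl mulrDl.
    - by exists (s * t); rewrite ?mulr_ge0// scalerA mulrA.
  have Dq u c : D u c -> c <= q u.
    move=> [t t0 [-> ->]]; move: t0; rewrite [0 <= t]le_eqVlt => /predU1P[<-|t0].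
      by rewrite scale0r mul0r (sublinear0 sq).
    have := sq.2 t^-1 (t *: y); rewrite invr_ge0 (ltW t0) => /(_ isT).
    by rewrite scalerA mulVf ?gt_eqF// scale1r [_^-1 * _]mulrC ler_pdivlMr// mulrC.
  rewrite -(qmin _ (cone_inf_sublinear sq cD Dq)); last exact: cone_inf_le_self.
  have Dy : D y (q y) by exists 1; rewrite ?scale1r ?mul1r.
  have := cone_inf_le sq cD Dq x Dy.
  rewrite (qmin _ (cone_inf_sublinear sq cD Dq)); last exact: cone_inf_le_self.
  by lra.
have q0 := sublinear0 sq.
have qN x : q (- x) = - q x by have := addq x (- x); rewrite subrr q0; lra.
have qZ t x : 0 <= t -> q (t *: x) = t * q x.
  move=> t0; apply/eqP; rewrite eq_le sq.2//=.
  by have := sq.2 t (- x) t0; rewrite scalerN !qN; lra.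
have lq : linear_for *%R q.
  move=> a x y; rewrite addq; congr (_ + _).
  have [a0|a0] := leP 0 a; first exact: qZ.
  by rewrite -[a]opprK scaleNr qN qZ ?oppr_ge0 ?ltW// !mulNr.
pose M := GRing.isLinear.Build R X R *%R q lq.
pose f : {scalar X} := HB.pack q M.
exists f; split=> [x|u c Cu]; rewrite /=.
  by apply: le_trans (qle x) _; exact: cone_inf_le_self.
have := cone_infN sp cC Cp Cu; have := qle (- u).
by rewrite qN; lra.
Qed.

End hahn_banach.

(** * Mazur's theorem, weak convergence and convergence in the Cantor space *)

Section mazur.
Context {R : realType} (X : normedModType R).

Definition convex_set (K : set X) : Prop :=
  forall (t : R) u v, 0 <= t <= 1 -> K u -> K v -> K (t *: u + (1 - t) *: v).

(** If K stayed at distance eps from z, the Mazur-Orlicz theorem for the norm and the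
cone of the pairs (t (u - z), t eps), with u in K, would give a functional of
norm at most 1 that is at least eps on K - z. *)
Lemma mazur (K : set X) (z : X) :
  convex_set K -> K !=set0 ->
  (forall (f : dual X) (eps : R), 0 < eps ->
     exists2 u, K u & `|sval f u - sval f z| < eps) ->
  forall eps : R, 0 < eps -> exists2 u, K u & `|u - z| < eps.
Proof.
move=> cK [k0 Kk0] hz eps e0; apply: contrapT => far.
have {}far u : K u -> eps <= `|u - z|.
  by move=> Ku; rewrite leNgt; apply/negP => ?; apply: far; exists u.
pose C (w : X) (c : R) := exists (t : R) u, [/\ 0 <= t, K u, w = t *: (u - z) & c = t * eps].
have cC : convex_cone C.
  split=> [|_ _ _ _ [s [u [s0 Ku -> ->]]] [t [v [t0 Kv -> ->]]]|
            s _ _ s0 [t [u [t0 Ku -> ->]]]].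
  - by exists 0, k0; rewrite scale0r mul0r.
  (* If both weights vanish, there is no convex combination to form. *)
  - have [st0|st0] := eqVneq (s + t) 0.
      have -> : s = 0 by lra.
      have -> : t = 0 by lra.
      by exists 0, k0; rewrite !scale0r !mul0r !addr0.
    exists (s + t), ((s / (s + t)) *: u + (1 - s / (s + t)) *: v); split.
    + exact: addr_ge0.
    + apply: cK => //; rewrite divr_ge0 ?addr_ge0//= ler_pdivrMr ?mul1r ?lerDl//.
      by rewrite lt_def st0 addr_ge0.
    + rewrite !scalerBr scalerDr !scalerA mulrBr mulr1 mulrCA mulfV// mulr1.
      by rewrite [s + t]addrC addrK scalerDl opprD addrACA [- (t *: z) - _]addrC.
    + by rewrite mulrDl.
  - by exists (s * t), u; rewrite mulr_ge0// scalerA mulrA.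
have sn : sublinear (fun x : X => `|x|).
  by split=> [x y|t x t0]; [exact: ler_normD|rewrite normrZ ger0_norm].
have Cn u c : C u c -> c <= `|u|.
  by move=> [t [v [t0 Kv -> ->]]]; rewrite normrZ ger0_norm// ler_wpM2l// far.
have [f [fle fC]] := mazur_orlicz sn cC Cn.
have fb x : `|f x| <= `|x|.
  by rewrite ler_norml fle andbT lerNl -linearN/= -[leRHS]normrN fle.
have cf : continuous (f : X -> R).
  apply: bounded_linear_continuous; apply/linear_boundedP.
  exists 1; split=> [|r r1 x]; first exact: num_real.
  by apply: le_trans (fb x) _; rewrite ler_peMl// ltW.
have [u Ku] := hz (exist _ f cf) _ e0; rewrite /= -linearB ltNge => /negP; apply.
apply: le_trans (ler_norm _); apply: fC.
by exists 1, u; rewrite scale1r mul1r.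
Qed.

(** Mazur's theorem for the convex set that consists of 0. *)
Lemma weakly_zero (z : X) : (forall f : dual X, sval f z = 0) -> z = 0.
Proof.
move=> fz; apply/eqP; rewrite -normr_eq0 -[_ == 0]negbK; apply/negP.
rewrite -normr_gt0 normr_id => z0.
have c0 : convex_set [set 0 : X].
  by move=> t u v _ /= -> ->; rewrite !scaler0 addr0.
have [||_ -> ] := @mazur [set 0] z c0 _ _ _ z0.
- by exists 0.
- by move=> f eps e0; exists 0; rewrite //= fz subr0 linear0 normr0.
- by rewrite sub0r normrN ltxx.
Qed.

(** The weak topology is a supremum of initial topologies, so that convergence is
tested by the functions that define it. *)
Lemma cvg_weak_space (F : set_system X) (x : X) : Filter F ->
  (F --> (x : weak_space X)) <->
  forall f : dual X, sval f y @[y --> F] --> sval f x.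
Proof.
move=> FF; split.
  move=> /cvg_sup cF f A Af.
  apply: (cF f); rewrite /= (@nbhsE (initial_topology (sval f : X -> R))).
  move: Af; rewrite nbhsE => -[B [oB Bx] BA]; exists (sval f @^-1` B).
    by split => //; exists B.
  by move=> y /BA.
move=> h; apply/cvg_sup => f A.
rewrite /= (@nbhsE (initial_topology (sval f : X -> R))) => -[_ [[B oB <-] Bx] BA].
by apply: filterS BA _; apply: (h f); apply: open_nbhs_nbhs.
Qed.

End mazur.

Lemma cvg_cantor (F : set_system cantor_space) (c : cantor_space) : Filter F ->
  (F --> c) <-> forall n : nat, \forall d \near F, d n = c n.
Proof.
move=> FF; split.
  move=> Fc n; apply: Fc.
  have /cvg_sup/(_ n) : nbhs c --> c by exact: cvg_id.
  apply; rewrite /= (@nbhsE (initial_topology (fun d : nat -> bool => d n))).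
  exists ((fun d : nat -> bool => d n) @^-1` [set c n]) => //.
  split => //; exists [set c n] => //; exact: discrete_open.
move=> h; apply/cvg_sup => n A.
rewrite /= (@nbhsE (initial_topology (fun d : nat -> bool => d n))) => -[_ [[B oB <-] Bx] BA].
by apply: filterS BA _; apply: filterS (h n) => d /= ->.
Qed.

(** * Countable ordinals *)

Lemma ord_le_refl x : ord_le x x.
Proof. by elim: x => I D f IH /= i Di; exists i. Qed.

Lemma ord_le_trans y x z : ord_le x y -> ord_le y z -> ord_le x z.
Proof.
elim: y x z => J E g IH [I D f] [K G h] /= xy yz i /xy[j Ej fg].
by have [k Gk gh] := yz _ Ej; exists k => //; exact: IH fg gh.
Qed.

Definition ord_lt (x y : countable_ord) : Prop :=
  let: OSup _ E g := y in exists2 j, E j & ord_le x (g j).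

Lemma ord_lt_le_trans y x z : ord_lt x y -> ord_le y z -> ord_lt x z.
Proof.
case: y z => J E g [K G h] /= [j Ej xg] /(_ _ Ej)[k Gk gh].
by exists k => //; exact: ord_le_trans gh.
Qed.

Lemma ord_lt_wf : well_founded ord_lt.
Proof.
suff h y x : ord_le x y -> Acc ord_lt x by move=> y; apply: h; exact: ord_le_refl.
elim: y x => J E g IH [I D f] /= xy; constructor => z [i /xy[j Ej fg] zf].
by apply: (IH j); exact: ord_le_trans fg.
Qed.

Lemma wf_of_rank (T : Type) (rel : T -> T -> Prop) (r : T -> countable_ord) :
  (forall x y, rel x y -> ord_lt (r x) (r y)) -> well_founded rel.
Proof.
move=> hr t; have [x xE] : exists x, x = r t by exists (r t).
elim/(well_founded_ind ord_lt_wf): x t xE => x IH t xE.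
by constructor => s st; apply: (IH (r s)) => //; rewrite xE; exact: hr.
Qed.

(** * Finite sets of integers as increasing sequences *)

Section finite_sets_as_sequences.
Implicit Types (s t : {fset nat}) (l : seq nat).

(** Finite sets are replaced by their increasing enumerations: adding a large element
becomes appending it, and the sets approaching a given set pointwise become the
end extensions of its enumeration. *)
Definition elems s : seq nat := sort leq s.
Definition fset_of l : {fset nat} := [fset x in l]%fset.

Lemma mem_fset_of l x : (x \in fset_of l) = (x \in l).
Proof. by rewrite inE. Qed.

Lemma mem_elems s x : (x \in elems s) = (x \in s).
Proof. by rewrite mem_sort. Qed.

Lemma size_elems s : size (elems s) = #|` s|.
Proof. by rewrite size_sort cardfE cardE -cardT /= -cardfE. Qed.

Lemma sorted_elems s : sorted ltn (elems s).
Proof. by rewrite ltn_sorted_uniq_leq sort_uniq fset_uniq sort_sorted//; exact: leq_total. Qed.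

Lemma elemsK s : fset_of (elems s) = s.
Proof. by apply/fsetP => x; rewrite mem_fset_of mem_elems. Qed.

Lemma sorted_ltn_inj l l' : sorted ltn l -> sorted ltn l' -> l =i l' -> l = l'.
Proof. exact: (irr_sorted_eq ltn_trans ltnn). Qed.

Lemma fset_ofK l : sorted ltn l -> elems (fset_of l) = l.
Proof.
move=> sl; apply: sorted_ltn_inj => //; first exact: sorted_elems.
by move=> x; rewrite mem_elems mem_fset_of.
Qed.

Lemma fkthE s k : fkth s k = nth 0%N (elems s) k.
Proof. by []. Qed.

Lemma sorted_ltn_nth l i j : sorted ltn l -> (i < j)%N -> (j < size l)%N ->
  (nth 0%N l i < nth 0%N l j)%N.
Proof. by move=> sl ij jl; apply: (sorted_ltn_nth ltn_trans) => //; rewrite inE// (ltn_trans ij). Qed.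

Lemma sorted_rcons_ltn l n : sorted ltn (rcons l n) =
  sorted ltn l && all (fun x => x < n)%N l.
Proof.
by rewrite !(sorted_pairwise ltn_trans) pairwise_rcons andbC.
Qed.

End finite_sets_as_sequences.

(** * Ranks in regular families *)

Section regular_families.
Context (R : set {fset nat}).
Implicit Types (a b s t : {fset nat}).

(** A subset of a moves to the right and becomes b.  Compared with the pointwise
comparison of enumerations, no positions have to be tracked when an element is
inserted in the middle. *)
Definition spread_of a b : Prop := exists g : nat -> nat,
  {in b &, injective g} /\ forall y, y \in b -> g y \in a /\ (g y <= y)%N.

Hypotheses (hR : hereditary R) (sR : spreading R).

(** Counting shows that the image of b under g is pointwise below b: for v the i-th
element of b, the elements of b up to v are sent to i + 1 elements up to v. *)
Lemma regular_spread_of a b : R a -> spread_of a b -> R b.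
Proof.
move=> Ra [g [ginj gab]]; pose a' := [fset g x | x in b]%fset.
have Ra' : R a'.
  by apply: hR Ra _; apply/fsubsetP => x /imfsetP[y /= /gab[ya _] ->].
have ca' : #|` a'| = #|` b| by rewrite card_in_imfset.
apply: (sR Ra' ca') => i; rewrite ca' !fkthE => ib.
rewrite leqNgt; apply/negP; set v := nth _ (elems b) i => vi.
have i_b : (i < size (elems b))%N by rewrite size_elems.
have hle : (count (leq^~ v) (elems a') <= i)%N.
  rewrite -(cat_take_drop i (elems a')) count_cat.
  have -> : count (leq^~ v) (drop i (elems a')) = 0%N.
    apply/eqP; rewrite eqn0Ngt -has_count; apply/hasPn => x /(nthP 0%N)[j].
    rewrite size_drop nth_drop -ltnNge => jlt <-; apply: leq_trans vi _.
    case: j jlt => [|j] jlt; first by rewrite addn0.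
    apply/ltnW/sorted_ltn_nth; [exact: sorted_elems|by rewrite addnS ltnS leq_addr|].
    by rewrite -ltn_subRL.
  by rewrite addn0; apply: leq_trans (count_size _ _) _; rewrite size_take; case: ifP => // /negbT; rewrite -leqNgt.
have : (i.+1 <= count (leq^~ v) (elems a'))%N.
  rewrite -size_filter; have <- : size [seq g x | x <- take i.+1 (elems b)] = i.+1.
    by rewrite size_map size_takel.
  apply: uniq_leq_size.
    rewrite map_inj_in_uniq ?take_uniq//; first by rewrite sort_uniq fset_uniq.
    by move=> x y /mem_take + /mem_take; rewrite !mem_elems; exact: ginj.
  move=> _ /mapP[x xb ->]; rewrite mem_filter mem_elems.
  have xb' : x \in b by rewrite -mem_elems (mem_take xb).
  apply/andP; split; last by apply/imfsetP; exists x.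
  apply: leq_trans (gab _ xb').2 _; move: xb => /(nthP 0%N)[j].
  rewrite size_takel// => ji <-; rewrite nth_take// /v.
  move: ji; rewrite ltnS leq_eqVlt => /predU1P[->//|ji].
  by apply/ltnW/sorted_ltn_nth => //; exact: sorted_elems.
by rewrite ltnNge hle.
Qed.

(** An element of s outside t moves to n and the remaining ones are dropped. *)
Lemma spread_of_fset1U t s n : (t `<` s)%fset -> (forall x, x \in s -> (x < n)%N) ->
  spread_of s (n |` t)%fset.
Proof.
move=> /andP[/fsubsetP ts /fsubsetPn[e es et]] sn.
have tn x : x \in t -> x != n by move=> /ts /sn; rewrite ltn_neqAle => /andP[].
exists (fun x => if x == n then e else x); split=> [x y|y].
  rewrite !in_fset1U; have [->|xn] := eqVneq x n; have [->|yn] := eqVneq y n => //=.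
    by move=> _ yt ey; rewrite ey yt in et.
  by move=> xt _ xe; rewrite -xe xt in et.
rewrite !in_fset1U; have [-> _|yn /= /ts ys] := eqVneq y n; last by [].
by split=> //; exact/ltnW/sn.
Qed.

Lemma regular_fset1U t s n : R s -> (t `<` s)%fset ->
  (forall x, x \in s -> (x < n)%N) -> R (n |` t)%fset.
Proof. by move=> Rs ts sn; apply: regular_spread_of Rs _; exact: spread_of_fset1U. Qed.

Context (rho : {fset nat} -> countable_ord).
Hypothesis rhoE : forall t, ord_eq (rho t) (OSup [set s | R s /\ (t `<` s)%fset] rho).

Lemma rank_lt s t : R s -> (t `<` s)%fset -> ord_lt (rho s) (rho t).
Proof.
move=> Rs ts; apply: ord_lt_le_trans (rhoE t).2.
by exists s => //; exact: ord_le_refl.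
Qed.

Lemma rank_wf : well_founded (fun s t => R s /\ (t `<` s)%fset).
Proof.
by apply: (wf_of_rank (r := rho)) => s t [Rs ts]; exact: rank_lt.
Qed.

(** Induction on rank.  A proper extension of a by several elements may be compared
with the extension of b by one huge element: all but one of the new elements are
dropped.  It matters that the new elements may lie between those of a. *)
Lemma rank_spread_of a b : R a -> spread_of a b -> ord_le (rho a) (rho b).
Proof.
elim/(well_founded_ind rank_wf): a b => a IH b Ra [g [ginj gab]].
apply: ord_le_trans (rhoE a).1 _; apply: ord_le_trans _ (rhoE b).2.
move=> s [Rs as_]; have /andP[/fsubsetP sa /fsubsetPn[e es ea]] := as_.
(* N exceeds the elements of b and of s, and takes the place of e. *)
pose N := (\max_(x <- enum_fset (b `|` s)%fset) x).+1.
have ltN x : x \in b \/ x \in s -> (x < N)%N.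
  move=> xbs; rewrite ltnS; apply: (@leq_bigmax_seq _ _ xpredT id) => //.
  by rewrite in_fsetU; case: xbs => ->; rewrite ?orbT.
have bN x : x \in b -> x != N.
  by move=> xb; have := ltN x (or_introl xb); rewrite ltn_neqAle => /andP[].
have Nb : N \notin b by apply/negP => /bN /eqP.
have sb' : spread_of s (N |` b)%fset.
  exists (fun x => if x == N then e else g x); split=> [x y|y].
    rewrite !in_fset1U; have [->|xn] := eqVneq x N; have [->|yn] := eqVneq y N => //=.
    - by move=> _ /gab[gya _] ey; rewrite ey gya in ea.
    - by move=> /gab[gxa _] _ xe; rewrite -xe gxa in ea.
    - by move=> xb yb; exact: ginj.
  rewrite !in_fset1U; have [-> _|yn /= /gab[gya gyy]] := eqVneq y N.
    by split=> //; apply/ltnW/ltN; right.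
  by split=> //; exact: sa.
exists (N |` b)%fset; last by apply: IH sb'; last exact: Rs.
split; first exact: regular_spread_of Rs sb'.
rewrite fproperE fsubsetU1 /=; apply/fsubsetPn; exists N => //.
by rewrite fset1U1.
Qed.

(** This turns ranks, which are suprema over all extensions of t, into ranks of
extensions by a single large element. *)
Lemma rank_fset1U t s n : R s -> (t `<` s)%fset ->
  (forall x, x \in s -> (x < n)%N) -> ord_le (rho s) (rho (n |` t)%fset).
Proof. by move=> Rs ts sn; apply: rank_spread_of => //; exact: spread_of_fset1U. Qed.

End regular_families.

(** * Increasing maps, enumerations and fusion *)

Definition strictly_increasing (f : nat -> nat) : Prop :=
  forall i j, (i < j)%N -> (f i < f j)%N.

Lemma strictly_increasing_le f i j : strictly_increasing f ->
  (i <= j)%N -> (f i <= f j)%N.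
Proof. by move=> hf; rewrite leq_eqVlt => /predU1P[->//|/hf/ltnW]. Qed.

Lemma strictly_increasing_ltP f i j : strictly_increasing f ->
  (f i < f j)%N = (i < j)%N.
Proof.
move=> hf; apply/idP/idP => [|/hf//]; apply: contraTT.
by rewrite -!leqNgt; exact: strictly_increasing_le.
Qed.

Lemma strictly_increasing_inj f : strictly_increasing f -> injective f.
Proof.
move=> hf i j fij; have [ij|ij|//] := ltngtP i j;
  by have := hf _ _ ij; rewrite fij ltnn.
Qed.

Lemma strictly_increasing_ge f i : strictly_increasing f -> (i <= f i)%N.
Proof.
by move=> hf; elim: i => // i IH; apply: leq_ltn_trans IH _; exact: hf.
Qed.

Lemma strictly_increasing_comp f g : strictly_increasing f ->
  strictly_increasing g -> strictly_increasing (f \o g).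
Proof. by move=> hf hg i j /hg/hf. Qed.

Lemma sorted_map_ltn f l : strictly_increasing f ->
  sorted ltn (map f l) = sorted ltn l.
Proof.
move=> hf; rewrite sorted_map; congr (sorted _ l).
by apply/funext => i; apply/funext => j; rewrite /relpre/= strictly_increasing_ltP.
Qed.

Section enumeration.
Variable L : set nat.
Hypothesis Loo : infinite_set L.

Let above N : exists m, (m \in L) && (N <= m)%N.
Proof.
apply: contrapT => h; apply: Loo; apply: (@sub_finite_set _ _ `I_N); last exact: finite_II.
move=> m Lm /=; rewrite ltnNge; apply/negP => Nm; apply: h; exists m.
by rewrite Nm andbT inE.
Qed.

Lemma kthP k : L (kth L k) /\ count (fun i => i \in L) (iota 0 (kth L k)) = k.
Proof.
rewrite /kth; apply: (@xgetPex _ 0%N [set m | L m /\ count (fun i => i \in L) (iota 0 m) = k]).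
elim: k => [|k [m [Lm mk]]] /=.
  have [m /andP[mL _] mmin] := ex_minnP (above 0); exists m.
  split; first by rewrite inE in mL.
  apply/eqP; rewrite eqn0Ngt -has_count; apply/hasPn => i; rewrite mem_iota /= add0n => im.
  by apply/negP => iL; have := mmin i; rewrite iL => /(_ isT); rewrite leqNgt im.
have [p /andP[pL mp] pmin] := ex_minnP (above m.+1); exists p.
split; first by rewrite inE in pL.
have -> : p = (m + (1 + (p - m.+1)))%N by lia.
rewrite iotaD count_cat mk add0n iotaD count_cat /= mem_set//=.
suff -> : count (fun i => i \in L) (iota (m + 1) (p - m.+1)) = 0%N by rewrite addn0 addn1.
apply/eqP; rewrite eqn0Ngt -has_count; apply/hasPn => i; rewrite mem_iota => im.
by apply/negP => iL; have := pmin i; rewrite iL /=; lia.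
Qed.

Lemma kth_strictly_increasing : strictly_increasing (kth L).
Proof.
move=> i j; apply: contraTT; rewrite -!leqNgt => ji.
have [_ <-] := kthP i; have [_ <-] := kthP j.
by rewrite -(subnKC ji) iotaD count_cat leq_addr.
Qed.

End enumeration.

Lemma infinite_range h : strictly_increasing h -> infinite_set (range h).
Proof.
move=> hh; rewrite (@eq_finite_set _ _ _ [set: nat]); first exact: infinite_nat.
by apply: inj_card_eq; move=> i j _ _; exact: strictly_increasing_inj.
Qed.

Lemma kth_range_ge h k : strictly_increasing h -> (h k <= kth (range h) k)%N.
Proof.
move=> hh.
have Loo := infinite_range hh.
elim: k => [|k IH].
  by have [[i _ <-] _] := kthP Loo 0; exact: strictly_increasing_le.
have [[i _ E] _] := kthP Loo k.+1; rewrite -E; apply: strictly_increasing_le => //.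
rewrite -(strictly_increasing_ltP _ _ hh) E; apply: leq_ltn_trans IH _.
exact: kth_strictly_increasing.
Qed.

(** The list of all subsequences, so that finitely many conditions are imposed at
each step of a fusion. *)
Fixpoint subseqs (h : seq nat) : seq (seq nat) :=
  if h is x :: h' then subseqs h' ++ map (cons x) (subseqs h') else [:: [::]].

Lemma mem_subseqs s h : subseq s h -> s \in subseqs h.
Proof.
elim: h s => [|x h IH] s /=; first by case: s.
case: s => [_|y s]; first by rewrite mem_cat IH ?sub0seq.
case: eqP => [-> sh|_ sh]; rewrite mem_cat; last by rewrite IH.
by rewrite map_f ?orbT// IH.
Qed.

Lemma subseq_iota s n : sorted ltn s -> all (fun x => x < n)%N s -> subseq s (iota 0 n).
Proof.
move=> ss sn; rewrite (_ : s = [seq x <- iota 0 n | x \in s]) ?filter_subseq//.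
apply: sorted_ltn_inj => //; first exact/(sorted_filter ltn_trans)/iota_ltn_sorted.
move=> x; rewrite mem_filter mem_iota /= add0n andb_idr// => xs.
exact: (allP sn).
Qed.

Lemma near_all_seq (S : Type) (F : set_system S) {FF : Filter F} (T : eqType)
    (l : seq T) (P : T -> S -> Prop) :
  (forall x, x \in l -> F [set n | P x n]) -> F [set n | forall x, x \in l -> P x n].
Proof.
elim: l => [_|x l IH h]; first by apply: filterS filterT => n _ x.
have Ux := h x (mem_head _ _).
have {}IH : F [set n | forall x, x \in l -> P x n].
  by apply: IH => y yl; apply: h; rewrite in_cons yl orbT.
by apply: filterS (filterI Ux IH) => n [/= Pxn Pln] y; rewrite in_cons => /predU1P[->//|/Pln].
Qed.

Section fusion.
Variable U : set_system nat.
Hypotheses (PU : ProperFilter U) (Uoo : \oo `<=` U).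

Lemma near_gt N : U [set n | (N < n)%N].
Proof. by apply: Uoo; exists N.+1. Qed.

Lemma near_gt_seq l : U [set n | all (fun x => x < n)%N l].
Proof.
apply: filterS (@near_all_seq _ U _ _ l (fun x n => x < n)%N _) => [n h|x _].
  exact/allP.
exact: near_gt.
Qed.

(** The condition on the next term may depend on all the terms already chosen; in the
applications it bears on all finite subsequences of these at once. *)
Lemma fusion (Phi : seq nat -> nat -> Prop) :
  (forall h, U [set n | Phi h n]) ->
  exists2 f, strictly_increasing f & forall i, Phi (mkseq f i) (f i).
Proof.
move=> UPhi.
have /choice[g gP] h : exists n, Phi h n /\ all (fun x => x < n)%N h.
  have [n [? ?]] := @filter_ex _ U _ _ (filterI (UPhi h) (near_gt_seq h)).
  by exists n.
pose H := fix H n := if n is n'.+1 then rcons (H n') (g (H n')) else [::].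
have HE i : mkseq (fun n => g (H n)) i = H i.
  elim: i => // i IH; rewrite /mkseq -addn1 iotaD map_cat /= add0n.
  by rewrite -/(mkseq _ _) IH addn1 /= cats1.
exists (fun n => g (H n)) => [i j ij|i]; last by rewrite HE; case: (gP (H i)).
have [_ /allP] := gP (H j); apply; rewrite -(HE j); apply/mapP; exists i => //.
by rewrite mem_iota.
Qed.

End fusion.

(** * Well founded trees of increasing sequences *)

(** [tree_good] says that the children of a node are either none or all the
admissible ones.  Thus a node at which a branch leaves the tree is a leaf, and a
nonleaf can be extended by every large n. *)
Record is_tree (T : seq nat -> Prop) : Prop := IsTree {
  tree0 : T [::];
  tree_sorted : forall l, T l -> sorted ltn l;
  tree_prefix : forall l n, T (rcons l n) -> T l;
  tree_good : forall l n n', T (rcons l n) -> sorted ltn (rcons l n') -> T (rcons l n');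
  tree_wf : well_founded (fun l' l => T l' /\ exists n, l' = rcons l n)
}.

Definition leaf (T : seq nat -> Prop) (l : seq nat) : Prop :=
  T l /\ forall n, ~ T (rcons l n).

Section trees.
Variable T : seq nat -> Prop.
Hypothesis tT : is_tree T.

Lemma tree_cat l l' : T (l ++ l') -> T l.
Proof.
elim/last_ind: l' => [|l' n IH]; first by rewrite cats0.
by rewrite -rcons_cat => /(tree_prefix tT)/IH.
Qed.

Lemma leaf_cat l l' : leaf T l -> T (l ++ l') -> l' = [::].
Proof.
by move=> [_ hl]; case: l' => // n l'; rewrite -cat_rcons => /tree_cat/hl.
Qed.

Lemma tree_nonleaf l n : T l -> ~ leaf T l -> sorted ltn (rcons l n) -> T (rcons l n).
Proof.
move=> Tl nl; apply: contraPP => nT sl; apply: nl; split=> // n' Tn'.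
by apply: nT; exact: tree_good Tn' sl.
Qed.

End trees.

(** * The tree of a regular family *)

Section tree_of_regular_family.
Variables (R : set {fset nat}) (rho : {fset nat} -> countable_ord) (L : set nat).
Hypotheses (hR : hereditary R) (sR : spreading R) (R0 : R fset0).
Hypothesis rhoE : forall t, ord_eq (rho t) (OSup [set s | R s /\ (t `<` s)%fset] rho).
Hypothesis Loo : infinite_set L.

(** Well-foundedness of proper extension: going up ends at a maximal member. *)
Lemma regular_hat s : R s -> hat (maximal_elements R) s.
Proof.
elim/(well_founded_ind (rank_wf rhoE)): s => s IH Rs.
have [smax|] := pselect (forall t, R t -> (s `<=` t)%fset -> t = s).
  by exists s; [split|exact: fsubset_refl].
move=> /existsNP[t /not_implyP[Rt /not_implyP[st ts]]].
have st' : (s `<` t)%fset by rewrite fproperEneq st andbT eq_sym; apply/eqP.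
have [r Fr tr] := IH t (conj Rt st') Rt.
by exists r => //; exact: fsubset_trans tr.
Qed.

Lemma fset_of_rcons l n : fset_of (rcons l n) = (n |` fset_of l)%fset.
Proof. by apply/fsetP => x; rewrite mem_fset_of mem_rcons in_cons in_fset1U mem_fset_of. Qed.

Lemma fset_of_rcons_proper l n : n \notin l -> (fset_of l `<` fset_of (rcons l n))%fset.
Proof.
move=> nl; rewrite fset_of_rcons fproperE fsubsetU1 /=; apply/fsubsetPn.
by exists n; rewrite ?fset1U1// mem_fset_of.
Qed.

Lemma sorted_rcons_notin l n : sorted ltn (rcons l n) -> n \notin l.
Proof.
rewrite sorted_rcons_ltn => /andP[_ /allP h].
by apply/negP => /h; rewrite ltnn.
Qed.

Definition pullback (m : nat -> nat) (l : seq nat) : Prop :=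
  sorted ltn l /\ R (fset_of (map m l)).

Lemma pullback_rank m l n : strictly_increasing m -> pullback m (rcons l n) ->
  ord_lt (rho (fset_of (map m (rcons l n)))) (rho (fset_of (map m l))).
Proof.
move=> hm [sl Rl]; apply: (rank_lt rhoE) => //; rewrite map_rcons.
apply: fset_of_rcons_proper; apply: sorted_rcons_notin.
by rewrite -map_rcons sorted_map_ltn.
Qed.

(** If s in R is not maximal, then s with n added lies in R for all large n, but
possibly not for all n beyond the maximum of s.  Fusion thins L so that it does,
for all sets s over the thinned set; this is [tree_good]. *)
Lemma pullback_tree : exists m, [/\ strictly_increasing m,
  forall i, L (m i) /\ (kth L i <= m i)%N,
  is_tree (pullback m) &
  forall l, leaf (pullback m) l -> maximal_elements R (fset_of (map m l))].
Proof.
have hk := kth_strictly_increasing Loo.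
pose Phi h n := forall s, s \in subseqs h ->
  (exists2 r, R r & (fset_of (map (kth L) s) `<` r)%fset) ->
  R (fset_of (map (kth L) (rcons s n))).
have UPhi h : \oo [set n | Phi h n].
  apply: near_all_seq => // s _.
  have [[r Rr sr]|nr] := pselect (exists2 r, R r & (fset_of (map (kth L) s) `<` r)%fset); last first.
    by apply: filterS filterT => n _ /nr.
  apply: filterS (@near_gt_seq \oo _ _ (enum_fset r)) => [n /allP rn _|//].
  rewrite map_rcons fset_of_rcons; apply: regular_fset1U Rr sr _ => // x /rn /leq_trans; apply.
  exact: strictly_increasing_ge.
have [f hf fPhi] := @fusion \oo _ (fun=> id) _ UPhi.
pose m := kth L \o f; have hm : strictly_increasing m by exact: strictly_increasing_comp.
have big : forall l (r : {fset nat}), sorted ltn l ->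
    exists n, sorted ltn (rcons l n) /\ forall x, x \in r -> (x < m n)%N.
  move=> l r sl.
  have [n [/= ln rn]] := @filter_ex _ \oo _ _ (filterI
     (@near_gt_seq \oo _ (fun=> id) l) (@near_gt_seq \oo _ (fun=> id) (enum_fset r))).
  exists n; rewrite sorted_rcons_ltn sl ln; split=> // x xr.
  by apply: leq_trans (allP rn x xr) _; exact: strictly_increasing_ge.
exists m; split; first exact: hm.
- move=> i; split; first by case: (kthP Loo (f i)).
  by apply: strictly_increasing_le => //; exact: strictly_increasing_ge.
- split.
  + split=> //; rewrite (_ : fset_of _ = fset0)//; apply/fsetP => x.
    by rewrite mem_fset_of in_fset0.
  + by move=> l [].
  + move=> l n [sl Rl]; split.
      by move: sl; rewrite sorted_rcons_ltn => /andP[].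
    by apply: hR Rl _; rewrite map_rcons fset_of_rcons fsubsetU1.
  + move=> l n n' [sl Rl] sl'; split=> //.
    have := fPhi n' (map f l) _; rewrite -!map_rcons -!map_comp; apply.
      apply: mem_subseqs; rewrite /mkseq map_subseq//; apply: subseq_iota.
        by move: sl'; rewrite sorted_rcons_ltn => /andP[].
      by move: sl'; rewrite sorted_rcons_ltn => /andP[].
    exists (fset_of (map m (rcons l n))) => //; rewrite map_rcons.
    apply: fset_of_rcons_proper; apply: sorted_rcons_notin.
    by rewrite -map_rcons sorted_map_ltn.
  + apply: (wf_of_rank (r := fun l => rho (fset_of (map m l)))) => l' l [+ [n E]].
    by rewrite E; exact: pullback_rank.
- move=> l [[sl Rl] lmax]; split=> // t Rt lt; apply: contrapT => tl.
  have lt' : (fset_of (map m l) `<` t)%fset.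
    by rewrite fproperEneq lt andbT eq_sym; apply/eqP.
  have [n [sn tn]] := big l t sl; apply: (lmax n); split=> //.
  by rewrite map_rcons fset_of_rcons; exact: regular_fset1U Rt lt' tn.
Qed.

End tree_of_regular_family.

(** * The game on several trees *)

(** The node reached by each player.  The players are numbered by the integers, and
each game involves those in a finite list J only. *)
Definition state := nat -> seq nat.

Section states.
Implicit Types (s t : state) (J : seq nat).

Definition start : state := fun=> [::].

Definition upd s j n : state := fun i => if i == j then rcons (s j) n else s i.

Lemma updE s j n : upd s j n j = rcons (s j) n.
Proof. by rewrite /upd eqxx. Qed.

Lemma upd_neq s j n i : i != j -> upd s j n i = s i.
Proof. by rewrite /upd => /negbTE ->. Qed.

(** The position (a, i) is the entry of index a of the player i.  In this
lexicographic order the positions are filled during the game. *)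
Definition before (a i b j : nat) : bool := (a < b)%N || (a == b) && (i < j)%N.

Definition eq_on J s t : Prop := {in J, forall j, s j = t j}.

Definition depends_on J (P : state -> Prop) : Prop :=
  forall s t, eq_on J s t -> P s -> P t.

(** The plegma condition in lexicographic form. *)
Definition interlaced J s : Prop := forall i j a b, i \in J -> j \in J ->
  (a < size (s i))%N -> (b < size (s j))%N -> before a i b j ->
  (nth 0%N (s i) a < nth 0%N (s j) b)%N.

End states.

Section game.
Implicit Types (s t : state) (J : seq nat).
Variables (U : set_system nat) (T : nat -> seq nat -> Prop).
Hypotheses (UU : UltraFilter U) (Uoo : \oo `<=` U).
Hypothesis hT : forall j, is_tree (T j).

Definition final J s : Prop := {in J, forall j, leaf (T j) (s j)}.
Definition legal J s : Prop := {in J, forall j, T j (s j)}.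

(** The player to move has the shortest node, and the smallest number among those.
With increasing choices this rule makes the final nodes interlaced, and every
interlaced family of leaves arises from it. *)
Definition turn J s j : Prop :=
  [/\ j \in J, ~ leaf (T j) (s j) &
  forall i, i \in J -> ~ leaf (T i) (s i) -> i != j ->
    before (size (s j)) j (size (s i)) i].

(** The iterated quantifier over U-almost all choices, along the well founded tree of
the positions of the game. *)
Inductive almost J (P : state -> Prop) : state -> Prop :=
| almost_final s : final J s -> P s -> almost J P s
| almost_step s j A : turn J s j -> U A ->
    (forall n, A n -> T j (rcons (s j) n)) ->
    (forall n, A n -> almost J P (upd s j n)) -> almost J P s.

Lemma turn_unique J s i j : turn J s i -> turn J s j -> i = j.
Proof.
move=> [iJ il ih] [jJ jl jh]; apply/eqP/negPn/negP => ij.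
have := jh i iJ il ij; have := ih j jJ jl; rewrite eq_sym ij => /(_ isT).
by rewrite /before; lia.
Qed.

Lemma turn_nfinal J s j : turn J s j -> ~ final J s.
Proof. by move=> [jJ jl _] /(_ _ jJ). Qed.

Lemma turn_exists J s : ~ final J s -> exists j, turn J s j.
Proof.
move=> nf; have [j0 j0J j0l] : exists2 j, j \in J & ~ leaf (T j) (s j).
  by apply: contrapT => h; apply: nf => j jJ; apply: contrapT => jl; apply: h; exists j.
(* First minimize the length of the node, then the number of the player. *)
pose Q a := `[< exists j, [/\ j \in J, ~ leaf (T j) (s j) & size (s j) = a] >].
have exQ : exists a, Q a by exists (size (s j0)); apply/asboolP; exists j0.
have [a /asboolP[j1 [j1J j1l j1a]] amin] := ex_minnP exQ.
pose Q' j := `[< [/\ j \in J, ~ leaf (T j) (s j) & size (s j) = a] >].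
have exQ' : exists j, Q' j by exists j1; apply/asboolP.
have [j /asboolP[jJ jl ja] jmin] := ex_minnP exQ'.
exists j; split=> // i iJ il ij; rewrite /before ja.
have : (a <= size (s i))%N by apply: amin; apply/asboolP; exists i.
rewrite leq_eqVlt => /predU1P[ai|->//]; apply/orP; right; rewrite ai eqxx /=.
by rewrite ltn_neqAle eq_sym ij; apply: jmin; apply/asboolP.
Qed.

Lemma legal_near J s j : legal J s -> turn J s j -> U [set n | T j (rcons (s j) n)].
Proof.
move=> ls [jJ jl _]; have Tj := ls _ jJ.
apply: filterS (@near_gt_seq U _ Uoo (s j)) => n /= hn.
apply: tree_nonleaf => //.
by rewrite sorted_rcons_ltn hn andbT; exact: (tree_sorted (hT j)).
Qed.

Lemma legal_upd J s j n : legal J s -> T j (rcons (s j) n) -> legal J (upd s j n).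
Proof.
move=> ls Tj i iJ; have [->|ij] := eqVneq i j; first by rewrite updE.
by rewrite upd_neq//; exact: ls.
Qed.

Definition move J s' s : Prop :=
  exists j n, [/\ j \in J, T j (rcons (s j) n) & s' = upd s j n].

(** Each move extends one node, and a product of finitely many well founded relations,
decreasing in one coordinate at a time, is well founded. *)
Lemma move_wf J : well_founded (move J).
Proof.
elim: J => [|j J IH]; first by move=> s; constructor => s' [j [n []]].
move=> s; have [l lE] : exists l, l = s j by exists (s j).
elim/(well_founded_ind (tree_wf (hT j))): l s lE => l IHl s.
elim/(well_founded_ind IH): s => s IHs lE.
constructor => s' [i [n [iJ Ti E]]]; have [ij|ij] := eqVneq i j.
  apply: (IHl (s' j)) => //; rewrite E ij updE lE -ij; split=> //.
  by exists n.
apply: IHs; last by rewrite E upd_neq// eq_sym.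
by exists i, n; split=> //; move: iJ; rewrite in_cons (negbTE ij).
Qed.

Lemma almost_turn J P s j : almost J P s -> turn J s j ->
  U [set n | T j (rcons (s j) n) /\ almost J P (upd s j n)].
Proof.
move=> as_ tj; case: as_ tj => {}s.
  by move=> fs _ /turn_nfinal.
move=> i A ti UA AT AP tj; rewrite (turn_unique tj ti).
by apply: filterS UA => n An; split; [exact: AT|exact: AP].
Qed.

Lemma almost_now J P s : almost J P s -> final J s -> P s.
Proof. by case=> // {}s j A /turn_nfinal. Qed.

Lemma almost_turnI J P s j : turn J s j ->
  U [set n | T j (rcons (s j) n) /\ almost J P (upd s j n)] -> almost J P s.
Proof. by move=> tj UA; apply: (almost_step tj UA) => n []. Qed.

Lemma almost_mono J (P Q : state -> Prop) s : (forall t, final J t -> P t -> Q t) ->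
  almost J P s -> almost J Q s.
Proof.
move=> PQ; elim=> {}s; first by move=> fs Ps; apply: almost_final => //; exact: PQ.
by move=> j A tj UA AT _ AQ; exact: almost_step tj UA AT AQ.
Qed.

Lemma almost_and J (P Q : state -> Prop) s : almost J P s -> almost J Q s ->
  almost J (fun t => P t /\ Q t) s.
Proof.
elim=> {}s.
  by move=> fs Ps aQ; apply: almost_final => //; split=> //; exact: almost_now aQ fs.
move=> j A tj UA AT _ IH aQ; apply: (almost_turnI tj).
by apply: filterS (filterI UA (almost_turn aQ tj)) => n [An [Tn aQn]]; split=> //; exact: IH.
Qed.

Lemma almost_ex J P s : almost J P s -> exists t, final J t /\ P t.
Proof.
elim=> {}s; first by exists s.
by move=> j A _ UA _ _ IH; have [n /IH] := @filter_ex _ U _ _ UA.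
Qed.

(** Together with [almost_and] and [almost_ex]: the sets of final positions that are
almost sure form an ultrafilter.  The step uses that U is one. *)
Lemma almost_em J P s : legal J s -> almost J P s \/ almost J (fun t => ~ P t) s.
Proof.
elim/(well_founded_ind (@move_wf J)): s => s IH ls.
have [fs|/turn_exists[j tj]] := pselect (final J s).
  by have [Ps|Ps] := pselect (P s); [left|right]; exact: almost_final.
have UT := legal_near ls tj; have jJ : j \in J by case: tj.
have [UP|UP] := in_ultra_setVsetC [set n | almost J P (upd s j n)] UU.
  by left; apply: (almost_turnI tj); apply: filterS (filterI UT UP).
right; apply: (almost_turnI tj); apply: filterS (filterI UT UP) => n [/= Tn nP].
split=> //; case: (IH (upd s j n)) => //; last exact: legal_upd.
by exists j, n.
Qed.

Lemma almost_inv J (Q : state -> Prop) s : legal J s -> Q s ->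
  (forall t j, Q t -> turn J t j -> U [set n | Q (upd t j n)]) -> almost J Q s.
Proof.
move=> + + hQ; elim/(well_founded_ind (@move_wf J)): s => s IH ls Qs.
have [fs|/turn_exists[j tj]] := pselect (final J s); first exact: almost_final.
have UT := legal_near ls tj; apply: (almost_turnI tj).
apply: filterS (filterI UT (hQ _ _ Qs tj)) => n [/= Tn Qn]; split=> //.
apply: IH => //; last exact: legal_upd.
by exists j, n; split=> //; case: tj.
Qed.

Lemma turn_sub J J' s s' j : {subset J' <= J} -> eq_on J' s s' ->
  turn J s j -> j \in J' -> turn J' s' j.
Proof.
move=> J'J ss' [jJ jl jmin] jJ'; split; rewrite -?ss'// => i iJ'.
by rewrite -ss'// => il ij; apply: jmin => //; exact: J'J.
Qed.

Lemma eq_on_upd J s s' j n : eq_on J s s' -> j \in J -> eq_on J (upd s j n) (upd s' j n).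
Proof.
move=> ss' jJ i iJ; have [->|ij] := eqVneq i j; first by rewrite !updE ss'.
by rewrite !upd_neq// ss'.
Qed.

Lemma eq_on_updr J s s' j n : eq_on J s s' -> j \notin J -> eq_on J (upd s j n) s'.
Proof.
move=> ss' jJ i iJ; rewrite upd_neq ?ss'//.
by apply: contraNneq jJ => <-.
Qed.

(** The choices of the players outside J' are irrelevant to P and do not change the
order in which the players of J' move, so that one of the almost sure choices can
be made for them. *)
Lemma almost_proj J J' P s s' : {subset J' <= J} -> depends_on J' P ->
  eq_on J' s s' -> almost J P s -> almost J' P s'.
Proof.
move=> J'J dP + aP; elim: aP s' => {}s.
  move=> fs Ps s' ss'; apply: almost_final; last exact: dP ss' Ps.
  by move=> j jJ'; rewrite -ss'//; exact/fs/J'J.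
move=> j A tj UA AT _ IH s' ss'; have [jJ'|jJ'] := boolP (j \in J').
  apply: (almost_step (turn_sub J'J ss' tj jJ') UA) => n An.
    by rewrite -ss'//; exact: AT.
  exact: (IH n An _ (eq_on_upd n ss' jJ')).
have [n An] := @filter_ex _ U _ _ UA.
exact: (IH n An _ (eq_on_updr n ss' jJ')).
Qed.

Lemma legal_start J : legal J start.
Proof. by move=> j _; exact: tree0 (hT j). Qed.

(** Otherwise the negation would be almost sure on J, hence on J'. *)
Lemma almost_lift J J' P : {subset J' <= J} -> depends_on J' P ->
  almost J' P start -> almost J P start.
Proof.
move=> J'J dP aP; case: (@almost_em J P start (@legal_start J)) => // aN.
have dN : depends_on J' (fun t => ~ P t).
  by move=> s t st Ps Pt; apply: Ps; apply: dP Pt => j jJ; rewrite st.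
have aN' : almost J' (fun t => ~ P t) start by apply: almost_proj J'J dN _ aN.
by have [t [_ [Pt /(_ Pt)]]] := almost_ex (almost_and aP aN').
Qed.

(** Invariant of the game: no position is skipped, except beyond a leaf. *)
Definition filled J s : Prop := forall i j a, i \in J -> j \in J ->
  (a < size (s i))%N -> ~ leaf (T j) (s j) -> before a i (size (s j)) j.

Lemma filled_upd J s j n : filled J s -> turn J s j -> filled J (upd s j n).
Proof.
move=> fs tj i k a iJ kJ; have [jJ jl jmin] := tj.
have [->|ij] := eqVneq i j; have [->|kj] := eqVneq k j.
- by rewrite updE size_rcons /before; lia.
- rewrite updE size_rcons ltnS leq_eqVlt upd_neq// => /predU1P[->|aj] kl.
    exact: jmin.
  exact: fs.
- by rewrite upd_neq// updE size_rcons => /(fs _ _ _ iJ jJ)/(_ jl); rewrite /before; lia.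
- by rewrite !upd_neq// => ai; exact: fs.
Qed.

(** Almost every choice exceeds N and all the entries present, and by [filled] its
position comes after theirs. *)
Lemma almost_interlaced J N : almost J (fun s => interlaced J s /\
  {in J, forall j, all (leq N) (s j)}) start.
Proof.
pose Q s := filled J s /\ (interlaced J s /\ {in J, forall j, all (leq N) (s j)}).
apply: (@almost_mono _ Q) => [s _ []//|].
apply: almost_inv; [exact: legal_start|by split|].
move=> s j [fs [ls Ns]] tj; have [jJ jl jmin] := tj.
have UA : U [set n | forall i, i \in J -> all (fun x => x < n)%N (s i)].
  by apply: near_all_seq => i _; exact: near_gt_seq.
apply: filterS (filterI UA (@near_gt U Uoo N)) => n [/= An Nn].
split; first exact: filled_upd.
split=> [i k a b iJ kJ|i iJ]; last first.
  have [->|ij] := eqVneq i j; last by rewrite upd_neq//; exact: Ns.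
  by rewrite updE all_rcons Ns// ltnW.
have [->|ij] := eqVneq i j; have [->|kj] := eqVneq k j.
- rewrite updE size_rcons !ltnS => aj bj /orP[ab|]; last by rewrite ltnn andbF.
  rewrite !nth_rcons (leq_trans ab bj); move: bj; rewrite leq_eqVlt.
  move=> /predU1P[bE|bj]; last by rewrite bj; apply: ls; rewrite ?/before ?ab ?(ltn_trans ab bj).
  by rewrite bE ltnn eqxx; apply: (allP (An j jJ)); rewrite mem_nth// -bE.
- rewrite updE (upd_neq _ _ kj) size_rcons ltnS nth_rcons leq_eqVlt.
  move=> /predU1P[->|aj] bk; last by rewrite aj; exact: ls.
  have [kl|kl] := pselect (leaf (T k) (s k)); last first.
    by have := jmin k kJ kl kj; have := fs k k b kJ kJ bk kl; have := fs k j b kJ jJ bk jl; rewrite /before; lia.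
  by have := fs k j b kJ jJ bk jl; rewrite /before; lia.
- rewrite updE (upd_neq _ _ ij) size_rcons ltnS => ai bj; rewrite nth_rcons.
  move: bj; rewrite leq_eqVlt => /predU1P[->|bj]; last by rewrite bj; exact: ls.
  by rewrite ltnn eqxx => _; apply: (allP (An i iJ)); rewrite mem_nth.
- by rewrite !upd_neq// => ai bk; exact: ls.
Qed.

Definition next J s n : state :=
  if pselect (exists j, turn J s j) is left e then upd s (sval (cid e)) n else s.

Lemma next_turn J s j n : turn J s j -> next J s n = upd s j n.
Proof.
move=> tj; rewrite /next; case: pselect => [e|[]]; last by exists j.
by rewrite (turn_unique tj (svalP (cid e))).
Qed.

(** Each condition P k l is almost sure, so U-almost every number is a correct move at
each position that is reached by correct moves.  The set built by fusion contains
only correct moves at all positions reachable with its elements, and an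
interlaced family of leaves over it is the result of playing its entries in
increasing order. *)
Lemma game_fusion (J : nat -> seq nat) (P : nat -> nat -> state -> Prop) :
  (forall k l, depends_on (J k) (P k l)) ->
  (forall k l, almost (J k) (P k l) start) ->
  exists2 f, strictly_increasing f &
    forall k l t, (k <= l.+1)%N -> final (J k) t -> interlaced (J k) t ->
      {in J k, forall j x, x \in t j -> exists2 i, (l <= i)%N & x = f i} ->
      P k l t.
Proof.
move=> dP aP; pose play k := foldl (next (J k)) start.
pose Phi h n := forall k, k \in iota 0 (size h).+2 -> forall l, l \in iota 0 (size h).+1 ->
  forall c, c \in subseqs h -> almost (J k) (P k l) (play k c) ->
  forall j, turn (J k) (play k c) j -> almost (J k) (P k l) (upd (play k c) j n).
have UPhi h : U [set n | Phi h n].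
  do 2! [apply: near_all_seq => ? _]; apply: near_all_seq => c _.
  set k := (X in play X); set l := (X in P k X).
  have [[ac [j tj]]|nac] := pselect (almost (J k) (P k l) (play k c) /\
      exists j, turn (J k) (play k c) j); last first.
    by apply: filterS filterT => n _ ac j tj; case: nac; split=> //; exists j.
  apply: filterS (almost_turn ac tj) => n [_ an] _ i ti.
  by rewrite (turn_unique ti tj).
have [f hf fPhi] := @fusion U _ Uoo _ UPhi; exists f => // k l t kl ft it tf.
(* The position s has been reached by playing f on the indices in c; induction
   on the moves that remain. *)
suff h s : forall c, s = play k (map f c) -> sorted ltn c -> filled (J k) s ->
    almost (J k) (P k l) s -> {in J k, forall j, prefix (s j) (t j)} ->
    {in c, forall x, exists i a, [/\ i \in J k, (a < size (s i))%N & f x = nth 0%N (t i) a]} ->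
    P k l t.
  apply: (h start [::]) => //.
  + by move=> j _; rewrite prefix0s.
elim/(well_founded_ind (@move_wf (J k))): s => s IH c sE sc fs as_ st cs.
have [fin|/turn_exists[j tj]] := pselect (final (J k) s).
  apply: dP (almost_now as_ fin) => i iJ.
  have /prefixP[r rE] := st i iJ.
  have -> : t i = s i ++ [::]; last by rewrite cats0.
  rewrite rE; congr (_ ++ _); apply: (leaf_cat (hT i) (fin i iJ)).
  by rewrite -rE; case: (ft i iJ).
have [jJ jl jmin] := tj.
have /prefixP[[|n r] rE] := st j jJ.
  by case: jl; move: (ft j jJ); rewrite rE cats0.
have [i li nE] : exists2 i, (l <= i)%N & n = f i.
  by apply: (tf j jJ); rewrite rE mem_cat mem_head orbT.
(* The next entry of t exceeds those already played, as its position comes later. *)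
have ci : all (fun x => x < i)%N c.
  apply/allP => x /cs[i' [a [i'J ai' fx]]].
  rewrite -(strictly_increasing_ltP _ _ hf) fx -nE.
  have -> : n = nth 0%N (t j) (size (s j)) by rewrite rE nth_cat ltnn subnn.
  apply: it => //; last exact: fs.
    by apply: leq_trans ai' _; apply: size_prefix; exact: st.
  by rewrite rE size_cat /= addnS ltnS leq_addr.
have Tj : T j (rcons (s j) n).
  by have [+ _] := ft j jJ; rewrite rE -cat_rcons => /(tree_cat (hT j)).
apply: (IH (upd s j n) _ (rcons c i)).
- by exists j, n.
- by rewrite map_rcons /play foldl_rcons -/(play k) -sE -nE (next_turn _ tj).
- by rewrite sorted_rcons_ltn sc.
- exact: filled_upd.
- rewrite nE sE; apply: (fPhi i k _ l _ (map f c)); rewrite -?sE//.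
  + by rewrite mem_iota size_mkseq; lia.
  + by rewrite mem_iota size_mkseq; lia.
  + by apply: mem_subseqs; rewrite /mkseq map_subseq// subseq_iota.
- move=> i' i'J; have [->|ij] := eqVneq i' j; last by rewrite upd_neq//; exact: st.
  by rewrite updE rE -cat_rcons prefix_prefix.
- move=> x; rewrite mem_rcons in_cons => /predU1P[->|/cs[i' [a [i'J ai' fx]]]].
    exists j, (size (s j)); split; rewrite ?updE ?size_rcons//.
    by rewrite -nE rE nth_cat ltnn subnn.
  exists i', a; split=> //; have [E|ij] := eqVneq i' j; last by rewrite upd_neq.
  by rewrite E updE size_rcons ltnS ltnW// -E.
Qed.

End game.

(** * Undoing the moves of some players *)

Section game_mazur.
Context {R : realType} (X : normedModType R).
Variables (U : set_system nat) (T : nat -> seq nat -> Prop).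
Hypotheses (UU : UltraFilter U) (Uoo : \oo `<=` U).
Hypothesis hT : forall j, is_tree (T j).
Variable v : nat -> seq nat -> X.
Hypothesis vweak : forall j l (f : dual X), T j l -> ~ leaf (T j) l ->
  sval f (v j (rcons l n)) @[n --> U] --> sval f (v j l).

Definition comb (a : nat -> R) (p : pred nat) (J : seq nat) (s : state) : X :=
  \sum_(j <- J | p j) a j *: v j (s j).

Lemma comb_eq_on a p J s t : eq_on [seq j <- J | p j] s t ->
  comb a p J s = comb a p J t.
Proof.
move=> st; rewrite /comb -[LHS]big_filter -[RHS]big_filter; apply: eq_big_seq => j jJ.
by rewrite st.
Qed.

Lemma comb_upd_notin a p J s j n : ~~ p j -> comb a p J (upd s j n) = comb a p J s.
Proof.
move=> pj; apply: comb_eq_on => i; rewrite mem_filter => /andP[pi _].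
by rewrite upd_neq//; apply: contraNneq pj => <-.
Qed.

(** Induction along the game.  Moves of players selected by p are kept.  When another
player moves, the set K of the vectors u for which the bound almost surely holds
with u in place of the contribution of the other players is convex; it contains
these contributions after almost all moves, and they converge weakly to the
contribution before the move.  Mazur's theorem gives a point of K close to it. *)
Lemma game_mazur a p J c s s' :
  legal T J s ->
  almost U T J (fun t => `|comb a xpredT J t| <= c) s ->
  eq_on [seq j <- J | p j] s s' ->
  forall eps : R, 0 < eps ->
  almost U T [seq j <- J | p j]
    (fun t => `|comb a p J t + comb a (predC p) J s| <= c + eps) s'.
Proof.
set J' := [seq j <- J | p j].
have J'J : {subset J' <= J} by move=> j; rewrite mem_filter => /andP[].
move=> + aP; elim: aP s' => {}s.
  move=> fs Pc s' ls ss' eps e0; apply: almost_final.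
    by move=> j jJ'; rewrite -ss'//; exact/fs/J'J.
  rewrite -(comb_eq_on _ ss'); apply: (@le_trans _ _ c); last by rewrite lerDl ltW.
  by move: Pc; rewrite /comb (bigID p).
move=> j A tj UA AT _ IH s' ls ss' eps e0.
have [jJ jl _] := tj.
have [pj|pj] := boolP (p j).
  have jJ' : j \in J' by rewrite mem_filter pj.
  apply: (almost_step (turn_sub J'J ss' tj jJ') UA) => n An.
    by rewrite -ss'//; exact: AT.
  have := IH n An _ (legal_upd ls (AT n An)) (eq_on_upd n ss' jJ') eps e0.
  by rewrite comb_upd_notin//= pj.
have jJ' : j \notin J' by rewrite mem_filter (negbTE pj).
pose z := comb a (predC p) J.
pose K := [set u : X | almost U T J' (fun t => `|comb a p J t + u| <= c + eps / 2) s'].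
have e2 : 0 < eps / 2 by rewrite divr_gt0.
have AK n : A n -> K (z (upd s j n)).
  by move=> An; apply: IH => //; [exact: legal_upd (AT n An)|exact: eq_on_updr].
have cK : convex_set K.
  move=> r x y /andP[r0 r1] Kx Ky; apply: almost_mono (almost_and UU Kx Ky) => t _ [hx hy].
  have -> : comb a p J t + (r *: x + (1 - r) *: y) =
      r *: (comb a p J t + x) + (1 - r) *: (comb a p J t + y).
    by rewrite !scalerDr addrACA -scalerDl [r + _]addrC subrK scale1r.
  apply: le_trans (ler_normD _ _) _; rewrite !normrZ ger0_norm// ger0_norm ?subr_ge0//.
  have : r * `|comb a p J t + x| <= r * (c + eps / 2) by rewrite ler_wpM2l.
  have : (1 - r) * `|comb a p J t + y| <= (1 - r) * (c + eps / 2).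
    by rewrite ler_wpM2l// subr_ge0.
  by lra.
have K0 : K !=set0.
  by have [n An] := @filter_ex _ U _ _ UA; exists (z (upd s j n)); exact: AK.
have zweak (f : dual X) : sval f (z (upd s j n)) @[n --> U] --> sval f (z s).
  have zE t : sval f (z t) = \sum_(i <- J | ~~ p i) a i * sval f (v i (t i)).
    by rewrite /z /comb linear_sum; apply: eq_bigr => i _; rewrite linearZ.
  rewrite zE; under eq_fun do rewrite zE.
  apply: cvg_big => [|i pi]; first exact: add_continuous.
  apply: cvgMl_tmp; have [->|ij] := eqVneq i j; last first.
    by under eq_fun do rewrite upd_neq//; exact: cvg_cst.
  by under eq_fun do rewrite updE; apply: vweak => //; exact: ls.
have [f r r0|u Ku uz] := mazur (z := z s) cK K0 _ e2.
  have := zweak f => /cvgrPdist_lt/(_ _ r0) Un.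
  have [n [An /= fn]] := @filter_ex _ U _ _ (filterI UA Un).
  by exists (z (upd s j n)); [exact: AK|rewrite distrC].
apply: almost_mono Ku => t _ ht.
have -> : comb a p J t + comb a (predC p) J s = (comb a p J t + u) - (u - z s).
  by rewrite opprB addrACA subrr addr0.
by apply: le_trans (ler_normB _ _) _; lra.
Qed.

End game_mazur.

(** * The spreading model of the sum of two families *)

(** The data extracted from a subordinated weakly null family that generates e: phi
extends the family to the tree T, weak continuity is tested on end extensions
only, and the rate of convergence is dropped. *)
Record tree_model {R : realType} {X : normedModType R} (T : seq nat -> Prop)
    (phi : seq nat -> X) (e : hamel_seq R) : Prop := TreeModel {
  model_tree : is_tree T;
  model_weak : forall l (f : dual X) (eps : R), T l -> 0 < eps ->
    exists N, forall u, T (l ++ u) -> all (leq N) u ->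
      `|sval f (phi (l ++ u)) - sval f (phi l)| < eps;
  model_null : phi [::] = 0;
  model_gen : forall k (a : 'I_k.+1 -> R) (eps : R), 0 < eps ->
    (forall i, `|a i| <= 1) ->
    exists N, forall t : 'I_k.+1 -> seq nat,
      (forall i, leaf T (t i)) ->
      (forall i j p q, (p < size (t i))%N -> (q < size (t j))%N ->
         before p i q j -> (nth 0 (t i) p < nth 0 (t j) q)%N) ->
      (forall i, all (leq N) (t i)) ->
      `| `|\sum_i a i *: phi (t i)| - comb_norm e a| <= eps
}.

Lemma comb_norm0 (R : realType) (e : hamel_seq R) (a : 'I_0 -> R) : comb_norm e a = 0.
Proof. by rewrite /comb_norm big_ord0 -(scale0r 0) hs_normZ normr0 mul0r. Qed.

Lemma comb_normZ (R : realType) (e : hamel_seq R) n (c : R) (a : 'I_n -> R) :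
  comb_norm e (fun i => c * a i) = `|c| * comb_norm e a.
Proof.
rewrite /comb_norm -hs_normZ scaler_sumr; congr (hs_norm _).
by apply: eq_bigr => i _; rewrite scalerA.
Qed.

Section join.
Context {R : realType} (X : normedModType R).
Variables (U : set_system nat).
Hypotheses (UU : UltraFilter U) (Uoo : \oo `<=` U).
Variables (T : bool -> seq nat -> Prop) (phi : bool -> seq nat -> X).
Variable (e : bool -> hamel_seq R).
Hypothesis hmodel : forall b, tree_model (T b) (phi b) (e b).

Let tree_of j := T (odd j).
Let v j := phi (odd j).
Let J k := iota 0 k.*2.
Let hT j : is_tree (tree_of j) := model_tree (hmodel (odd j)).

(** Even players move in the first tree and odd players in the second one; player
2i is immediately followed by player 2i + 1. *)
Definition pair_vec (i : nat) (s : state) : X :=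
  phi false (s i.*2) + phi true (s i.*2.+1).
Let w := pair_vec.

Lemma mem_J k i (b : bool) : (i < k)%N -> (i.*2 + b)%N \in J k.
Proof. by move=> ik; rewrite mem_iota leq0n add0n -!muln2; case: b => /=; lia. Qed.

Lemma pair_vec_eq_on k i s t : (i < k)%N -> eq_on (J k) s t -> w i s = w i t.
Proof.
move=> ik st; rewrite /w /pair_vec -[X in s X]addn0 -addn1 !st ?addn0 ?addn1//.
  by have := mem_J true ik; rewrite addn1.
by have := mem_J false ik; rewrite addn0.
Qed.

Lemma J_S k : J k.+1 = J k ++ [:: k.*2; k.*2.+1].
Proof. by rewrite /J doubleS -addn2 iotaD. Qed.

Lemma comb_J (c : nat -> R) k s :
  comb v (fun j => c j./2) xpredT (J k) s = \sum_(i < k) c i *: w i s.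
Proof.
elim: k => [|k IH]; first by rewrite big_ord0 /comb big_nil.
rewrite big_ord_recr /= -IH J_S /comb big_cat /=; congr (_ + _).
rewrite !big_cons big_nil addr0 doubleK /= uphalf_double /v /= odd_double /=.
by rewrite /w /pair_vec scalerDr.
Qed.

Lemma comb_J_parity b (c : nat -> R) k s :
  comb v (fun j => c j./2) (fun j => odd j == b) (J k) s =
  \sum_(i < k) c i *: phi b (s (i.*2 + b)%N).
Proof.
elim: k => [|k IH]; first by rewrite big_ord0 /comb big_nil.
rewrite big_ord_recr /= -IH J_S /comb big_cat /=; congr (_ + _).
rewrite !big_cons big_nil doubleK /= uphalf_double /v /= odd_double /=.
by case: b {IH} => /=; rewrite ?addr0 ?addn0 ?addn1.
Qed.

Lemma model_vweak j l (f : dual X) : tree_of j l -> ~ leaf (tree_of j) l ->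
  sval f (v j (rcons l n)) @[n --> U] --> sval f (v j l).
Proof.
move=> Tl nl; apply/cvgrPdist_lt => eps e0.
have [N hN] := model_weak (hmodel (odd j)) f Tl e0.
apply: filterS (filterI (@near_gt_seq U _ Uoo l) (@near_gt U Uoo N)) => n [/= ln Nn].
rewrite distrC -cats1; apply: hN; last by rewrite /= ltnW.
rewrite cats1; apply: (tree_nonleaf (hT j) Tl nl).
by rewrite sorted_rcons_ltn ln (tree_sorted (hT j) Tl).
Qed.

(** The union, over the number of players, of the ultrafilters of almost sure sets. *)
Definition eventually_almost (P : set state) : Prop := exists k (Q : set state),
  [/\ depends_on (J k) Q, almost U tree_of (J k) Q start & Q `<=` P].

Lemma J_sub k k' : (k <= k')%N -> {subset J k <= J k'}.
Proof. by move=> kk' j; rewrite !mem_iota !leq0n !add0n -!muln2; lia. Qed.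

Lemma depends_on_sub (K K' : seq nat) (P : set state) : {subset K <= K'} ->
  depends_on K P -> depends_on K' P.
Proof. by move=> KK' dP s t st; apply: dP => j /KK'/st. Qed.

Lemma eventually_almost_filter : ProperFilter eventually_almost.
Proof.
apply: Build_ProperFilter_ex.
  by move=> P [k [Q [_ /(almost_ex UU)[t [_ Qt]] QP]]]; exists t; exact: QP.
split.
- exists 0%N, setT; split=> //; exact: almost_final.
- move=> P P' [k [Q [dQ aQ QP]]] [k' [Q' [dQ' aQ' QP']]].
  exists (maxn k k'), (Q `&` Q'); split.
  + move=> s t st [Qs Q's]; split.
      by apply: (depends_on_sub (J_sub (leq_maxl k k')) dQ) st Qs.
    by apply: (depends_on_sub (J_sub (leq_maxr k k')) dQ') st Q's.
  + apply: almost_and => //; apply: almost_lift => //; last first.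
    * exact: aQ'.
    * exact: dQ'.
    * exact: J_sub (leq_maxr _ _).
    * exact: aQ.
    * exact: dQ.
    * exact: J_sub (leq_maxl _ _).
  + by move=> s [/QP ? /QP' ?].
- by move=> P P' PP' [k [Q [dQ aQ QP]]]; exists k, Q; split=> // s /QP/PP'.
Qed.

Variable V : set_system state.
Hypotheses (VU : UltraFilter V) (V_almost : eventually_almost `<=` V).

Lemma almost_V k (P : set state) : depends_on (J k) P -> almost U tree_of (J k) P start -> V P.
Proof. by move=> dP aP; apply: V_almost; exists k, P; split. Qed.

(** On sets that depend on finitely many players, V adds nothing. *)
Lemma V_almostP k (P : set state) : depends_on (J k) P -> V P -> almost U tree_of (J k) P start.
Proof.
move=> dP VP; have [//|aN] := @almost_em U tree_of UU Uoo hT (J k) P start (@legal_start tree_of hT (J k)).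
have VN : V (~` P).
  by apply: almost_V aN => s t st Ps Pt; apply: Ps; apply: dP Pt => j jJ; rewrite st.
by have [t []] := @filter_ex _ V _ _ (filterI VP VN).
Qed.

Let B : R := \sum_(b : bool) (comb_norm (e b) (fun _ : 'I_1 => 1) + 1).

(** For one vector the generating condition compares the norm with that of the first
basis vector. *)
Lemma pair_vec_bounded k : V [set s | forall i, (i < k)%N -> `|w i s| <= B].
Proof.
have bd b : exists N, forall l, leaf (T b) l -> all (leq N) l ->
    `|phi b l| <= comb_norm (e b) (fun _ : 'I_1 => 1) + 1.
  have [||N hN] := model_gen (hmodel b) (a := fun _ : 'I_1 => 1) (eps := 1).
  - exact: ltr01.
  - by move=> _; rewrite normr1.
  exists N => l ll lN.
  have : `| `|phi b l| - comb_norm (e b) (fun _ : 'I_1 => 1)| <= 1.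
    have := hN (fun=> l) (fun=> ll) _ (fun=> lN); rewrite big_ord1 scale1r; apply.
    move=> i j p q pl ql; rewrite !ord1 /before ltnn andbF orbF => pq.
    by apply: sorted_ltn_nth => //; apply: (tree_sorted (model_tree (hmodel b))); case: ll.
  by rewrite ler_norml => /andP[_]; rewrite lerBlDl addrC.
have [N0 h0] := bd false; have [N1 h1] := bd true.
apply: (@almost_V k).
  by move=> s t st Ps i ik; rewrite -(pair_vec_eq_on ik st); exact: Ps.
apply: almost_mono (almost_interlaced UU Uoo hT (J k) (maxn N0 N1)) => s fs [_ Ns] i ik.
have e0 := mem_J false ik; have e1 := mem_J true ik.
rewrite addn0 in e0; rewrite addn1 in e1.
rewrite /w /pair_vec; apply: le_trans (ler_normD _ _) _.
rewrite /B big_bool /= addrC; apply: lerD.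
  apply: h0.
    by have := fs _ e0; rewrite /tree_of /= odd_double.
  by apply: sub_all (Ns _ e0) => x; apply: leq_trans; exact: leq_maxl.
apply: h1.
  by have := fs _ e1; rewrite /tree_of /= odd_double.
by apply: sub_all (Ns _ e1) => x; apply: leq_trans; exact: leq_maxr.
Qed.

Implicit Types p q : {poly R}.

(** Polynomials serve as the space of the finite combinations of a Hamel basis, the
basis being the monomials. *)
Definition poly_vec (p : {poly R}) (s : state) : X := \sum_(i < size p) p`_i *: w i s.

Lemma poly_vec_widen p k s : (size p <= k)%N ->
  poly_vec p s = \sum_(i < k) p`_i *: w i s.
Proof.
move=> pk; rewrite /poly_vec -(subnKC pk) big_split_ord /=.
rewrite [X in _ + X]big1 ?addr0// => i _.
by rewrite nth_default ?leq_addr// scale0r.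
Qed.

Lemma poly_vecD p q s : poly_vec (p + q) s = poly_vec p s + poly_vec q s.
Proof.
pose k := maxn (size p) (size q).
rewrite !(@poly_vec_widen _ k) ?leq_maxl ?leq_maxr//; last exact: size_polyD.
by rewrite -big_split; apply: eq_bigr => i _; rewrite coefD scalerDl.
Qed.

Lemma poly_vecZ c p s : poly_vec (c *: p) s = c *: poly_vec p s.
Proof.
rewrite (@poly_vec_widen _ (size p)) ?size_scale_leq// /poly_vec scaler_sumr.
by apply: eq_bigr => i _; rewrite coefZ scalerA.
Qed.

Definition polyn n (a : 'I_n -> R) : {poly R} := \sum_(i < n) a i *: 'X^i.

Lemma coef_polyn n (a : 'I_n -> R) (i : 'I_n) : (polyn a)`_i = a i.
Proof.
rewrite /polyn coef_sum (bigD1 i)//= coefZ coefXn eqxx mulr1 big1 ?addr0// => j ji.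
by rewrite coefZ coefXn eq_sym (inj_eq val_inj) (negbTE ji) mulr0.
Qed.

Lemma size_polyn n (a : 'I_n -> R) : (size (polyn a) <= n)%N.
Proof.
apply/leq_sizeP => j nj; rewrite /polyn coef_sum big1// => i _.
rewrite coefZ coefXn (_ : (j == i) = false) ?mulr0//.
by apply/negbTE; rewrite neq_ltn (leq_trans (ltn_ord i) nj) orbT.
Qed.

Lemma poly_vec_polyn n (a : 'I_n -> R) s : poly_vec (polyn a) s = \sum_(i < n) a i *: w i s.
Proof.
rewrite (poly_vec_widen _ (size_polyn a)); apply: eq_bigr => i _.
by rewrite coef_polyn.
Qed.

Definition poly_norm (p : {poly R}) : R := lim (`|poly_vec p s| @[s --> V]).

Lemma ultra_cvg (g : state -> R) (M : R) : V [set s | 0 <= g s <= M] ->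
  g s @[s --> V] --> lim (g s @[s --> V]).
Proof.
move=> Vg; suff : cvg (g s @[s --> V]) by [].
have Vg' : (g s @[s --> V]) `[0, M]%classic.
  change (V (g @^-1` `[0, M]%classic)); apply: filterS Vg => s hs.
  by rewrite /= in_itv.
have [r [_ cr]] := segment_compact (fmap_proper_filter g _) Vg'.
apply/cvg_ex; exists r => A Ar; rewrite /= nbhs_filterE /fmap /=.
have [//|VnA] := in_ultra_setVsetC (g @^-1` A) VU.
by have [y []] := cr (~` A) A VnA Ar.
Qed.

Lemma poly_norm_cvg p : `|poly_vec p s| @[s --> V] --> poly_norm p.
Proof.
apply: (@ultra_cvg _ (\sum_(i < size p) `|p`_i| * B)).
apply: filterS (pair_vec_bounded (size p)) => s hs /=; rewrite normr_ge0 /=.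
apply: le_trans (ler_norm_sum _ _ _) _; apply: ler_sum => i _.
by rewrite normrZ ler_wpM2l// hs.
Qed.

Lemma poly_normD p q : poly_norm (p + q) <= poly_norm p + poly_norm q.
Proof.
rewrite -subr_ge0.
have h := cvgB (cvgD (@poly_norm_cvg p) (@poly_norm_cvg q)) (@poly_norm_cvg (p + q)).
apply: (cvgr_to_ge (h _ _)); apply: filterE => s.
by rewrite !fctE /= subr_ge0 poly_vecD; exact: ler_normD.
Qed.

Lemma poly_normZ c p : poly_norm (c *: p) = `|c| * poly_norm p.
Proof.
have h1 := @poly_norm_cvg (c *: p).
have h2 : `|poly_vec (c *: p) s| @[s --> V] --> `|c| * poly_norm p.
  under eq_fun do rewrite poly_vecZ normrZ.
  by apply: cvgMl_tmp; exact: poly_norm_cvg.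
exact: (cvg_unique _ h1 h2).
Qed.

Lemma poly_norm_free n (a : 'I_n -> R) :
  \sum_(i < n) a i *: 'X^i = 0 :> {poly R} -> forall i, a i = 0.
Proof. by move=> h i; rewrite -coef_polyn /polyn h coef0. Qed.

Lemma poly_norm_span (p : {poly R}) : exists n (a : 'I_n -> R), p = \sum_(i < n) a i *: 'X^i.
Proof.
exists (size p), (fun i => p`_i); rewrite -[LHS]coefK poly_def.
by apply: eq_bigr.
Qed.

Definition join_seq : hamel_seq R :=
  HamelSeq poly_normD poly_normZ poly_norm_free poly_norm_span.

Lemma join_near n (a : 'I_n -> R) (eps : R) : 0 < eps ->
  V [set s | `| `|\sum_(i < n) a i *: w i s| - comb_norm join_seq a| < eps].
Proof.
move=> e0; have /cvgrPdist_lt/(_ _ e0) := @poly_norm_cvg (polyn a).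
by apply: filterS => s; rewrite poly_vec_polyn distrC.
Qed.

Lemma sum_pair_vec_le k (c : 'I_k -> R) s : (forall i, (i < k)%N -> `|w i s| <= B) ->
  `|\sum_(i < k) c i *: w i s| <= \sum_(i < k) `|c i| * B.
Proof.
move=> hs; apply: le_trans (ler_norm_sum _ _ _) _; apply: ler_sum => i _.
by rewrite normrZ ler_wpM2l// hs.
Qed.

Lemma comb_norm_join_le k (c : 'I_k -> R) :
  comb_norm join_seq c <= \sum_(i < k) `|c i| * B.
Proof.
apply: (cvgr_to_le (@poly_norm_cvg (polyn c))).
apply: filterS (pair_vec_bounded k) => s hs.
by rewrite poly_vec_polyn; exact: sum_pair_vec_le.
Qed.

Lemma comb_norm_dist k (h : hamel_seq R) (a b : 'I_k -> R) :
  `|comb_norm h a - comb_norm h b| <= comb_norm h (fun i => a i - b i).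
Proof.
have hh (c d : 'I_k -> R) : comb_norm h c <= comb_norm h (fun i => c i - d i) + comb_norm h d.
  apply: le_trans (hs_normD _ _); rewrite -big_split /=.
  rewrite /comb_norm (eq_bigr (fun i => (c i - d i) *: hs_vec h i + d i *: hs_vec h i))// => i _.
  by rewrite -scalerDl subrK.
rewrite ler_norml; apply/andP; split; last by rewrite lerBlDr hh.
rewrite lerNl opprB lerBlDr; apply: le_trans (hh b a) _; rewrite lerD2r.
rewrite (_ : comb_norm h (fun i => a i - b i) = comb_norm h (fun i => b i - a i))//.
rewrite -[LHS]mul1r -(normrN1 R) -comb_normZ; congr comb_norm.
by apply/funext => i; rewrite mulN1r opprB.
Qed.

Definition close_to_join k l : set state := [set s | forall a : 'I_k -> R,
  (forall i, `|a i| <= 1) ->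
  `| `|\sum_(i < k) a i *: w i s| - comb_norm join_seq a| <= l.+1%:R^-1].

Lemma close_to_join_depends k l : depends_on (J k) (close_to_join k l).
Proof.
move=> s t st cs a a1; have := cs a a1.
by under eq_bigr => i _ do rewrite (pair_vec_eq_on (ltn_ord i) st).
Qed.

(** For one coefficient vector this is the definition of the limit.  Both norms are
Lipschitz functions of the coefficients, uniformly on a set of V, so compactness
of the cube makes it uniform in the coefficients. *)
Lemma close_to_join_V k l : V (close_to_join k l).
Proof.
pose K := [set x : 'rV[R]_k | forall i, `[-1, 1]%classic (x ord0 i)].
have cK : compact K by apply: (@rV_compact R k (fun=> `[-1, 1]%classic)) => _; exact: segment_compact.
pose eps : R := l.+1%:R^-1.
have eps0 : 0 < eps by rewrite invr_gt0.
pose P (s : state) (x : 'rV[R]_k) := `| `|\sum_(i < k) x ord0 i *: w i s| -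
  comb_norm join_seq (x ord0)| <= eps.
have cov : V [set s | K `<=` P s].
  apply: (iffLR (compact_near_coveringP K) cK state V P) => x Kx.
  (* A change of the coefficients by eta moves both norms by at most eps / 3; the
   added 1 keeps the denominator positive. *)
  pose eta := eps / (3 * (k%:R * `|B| + 1)).
  have den0 : 0 < 3 * (k%:R * `|B| + 1) by rewrite mulr_gt0// ltr_wpDl.
  have eta0 : 0 < eta by rewrite divr_gt0.
  have e3 : 0 < eps / 3 by rewrite divr_gt0.
  exists ([set y : 'rV[R]_k | forall i, `|x ord0 i - y ord0 i| < eta],
     [set s | forall i, (i < k)%N -> `|w i s| <= B] `&`
     [set s | `| `|\sum_(i < k) x ord0 i *: w i s| - comb_norm join_seq (x ord0)| < eps / 3]).
    split => /=.
      have hx i : nbhs x [set y : 'rV[R]_k | `|x ord0 i - y ord0 i| < eta].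
        by have /cvgrPdist_lt := @coord_continuous R 1 k ord0 i x; exact.
      exact: (filter_forall (nbhs_filter x) hx).
    by apply: filterI; [exact: pair_vec_bounded|exact: join_near].
  move=> [y s] [/= hy [hB hx]].
  have {}hx : `| `|\sum_(i < k) x ord0 i *: w i s| - comb_norm join_seq (x ord0)| < eps / 3.
    exact: hx.
  have small : \sum_(i < k) `|x ord0 i - y ord0 i| * B <= eps / 3.
    apply: (@le_trans _ _ (\sum_(i < k) eta * `|B|)).
      apply: ler_sum => i _; apply: (@le_trans _ _ (`|x ord0 i - y ord0 i| * `|B|)).
        by rewrite ler_wpM2l// ler_norm.
      by rewrite ler_wpM2r// ltW.
    have -> : \sum_(i < k) eta * `|B| = eta * `|B| * k%:R.
      by rewrite sumr_const card_ord mulr_natr.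
    have : eta * (3 * (k%:R * `|B| + 1)) = eps by rewrite divfK// gt_eqF.
    by rewrite mulrA mulrDr; lra.
  have d1 : `|comb_norm join_seq (x ord0) - comb_norm join_seq (y ord0)| <= eps / 3.
    by apply: le_trans (comb_norm_dist _ _ _) _; apply: le_trans (comb_norm_join_le _) small.
  have d2 : `| `|\sum_(i < k) x ord0 i *: w i s| - `|\sum_(i < k) y ord0 i *: w i s| | <= eps / 3.
    apply: le_trans (ler_dist_dist _ _) _; rewrite -sumrB.
    under eq_bigr do rewrite -scalerBl.
    by apply: le_trans (sum_pair_vec_le _ hB) small.
  move: d1 d2 hx; rewrite /P !ler_norml !ltr_norml => /andP[? ?] /andP[? ?] /andP[? ?].
  by apply/andP; split; lra.
apply: filterS cov => s hs a a1.
have := hs (\row_i a i); rewrite /P.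
have -> : (\row_i a i) ord0 = a by apply/funext => i; rewrite mxE.
by apply=> i /=; rewrite mxE in_itv /= -ler_norml.
Qed.

Lemma join_fusion : exists2 f, strictly_increasing f &
  forall k l t, (k <= l.+1)%N -> final tree_of (J k) t -> interlaced (J k) t ->
    {in J k, forall j x, x \in t j -> exists2 i, (l <= i)%N & x = f i} ->
    close_to_join k l t.
Proof.
apply: (@game_fusion U tree_of UU Uoo hT J close_to_join close_to_join_depends) => k l.
by apply: V_almostP; [exact: close_to_join_depends|exact: close_to_join_V].
Qed.

Lemma interlaced_parity (b : bool) k s : interlaced (J k) s ->
  forall (i j : 'I_k) (p q : nat),
  (p < size (s (i.*2 + b)%N))%N -> (q < size (s (j.*2 + b)%N))%N -> before p i q j ->
  (nth 0%N (s (i.*2 + b)%N) p < nth 0%N (s (j.*2 + b)%N) q)%N.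
Proof.
move=> ls i j p q hp hq ij; apply: ls => //; try exact: mem_J.
by move: ij; rewrite /before -!muln2; case: b {hp hq} => /=; lia.
Qed.

Lemma final_parity (b : bool) k s : final tree_of (J k) s -> forall i : 'I_k, leaf (T b) (s (i.*2 + b)%N).
Proof.
move=> fs i; have := fs _ (mem_J b (ltn_ord i)).
by rewrite /tree_of oddD odd_double oddb.
Qed.

(** The triangle inequality at one final position that is good for the three norms. *)
Lemma join_le_bounded k (a : 'I_k.+1 -> R) : (forall i, `|a i| <= 1) ->
  comb_norm join_seq a <= comb_norm (e false) a + comb_norm (e true) a.
Proof.
move=> a1; apply/ler_addgt0Pr => eps eps0.
have e3 : 0 < eps / 3 by rewrite divr_gt0.
have [N0 h0] := model_gen (hmodel false) e3 a1.
have [N1 h1] := model_gen (hmodel true) e3 a1.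
have dN : depends_on (J k.+1) [set s | `| `|\sum_(i < k.+1) a i *: w i s| - comb_norm join_seq a| < eps / 3].
  move=> s t st /=; by under eq_bigr => i _ do rewrite (pair_vec_eq_on (ltn_ord i) st).
have aN := V_almostP dN (join_near a e3).
have [s [fs [hs [ls Ns]]]] := almost_ex UU (almost_and UU aN
  (almost_interlaced UU Uoo hT (J k.+1) (maxn N0 N1))).
have {}hs : `| `|\sum_(i < k.+1) a i *: w i s| - comb_norm join_seq a| < eps / 3 := hs.
have {}h0 := h0 (fun i => s (i.*2 + false)%N) (@final_parity false _ _ fs) (@interlaced_parity false _ _ ls) _.
have {}h1 := h1 (fun i => s (i.*2 + true)%N) (@final_parity true _ _ fs) (@interlaced_parity true _ _ ls) _.
have {}h0 : `| `|\sum_i a i *: phi false (s (i.*2 + false)%N)| - comb_norm (e false) a| <= eps / 3.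
  by apply: h0 => i; apply: sub_all (Ns _ (mem_J _ (ltn_ord i))) => x; apply: leq_trans; exact: leq_maxl.
have {}h1 : `| `|\sum_i a i *: phi true (s (i.*2 + true)%N)| - comb_norm (e true) a| <= eps / 3.
  by apply: h1 => i; apply: sub_all (Ns _ (mem_J _ (ltn_ord i))) => x; apply: leq_trans; exact: leq_maxr.
have : `|\sum_(i < k.+1) a i *: w i s| <=
  `|\sum_i a i *: phi false (s (i.*2 + false)%N)| + `|\sum_i a i *: phi true (s (i.*2 + true)%N)|.
  apply: le_trans (ler_normD _ _); rewrite -big_split /= le_eqVlt.
  apply/orP; left; apply/eqP; congr (`|_|); apply: eq_bigr => i _.
  by rewrite /w /pair_vec scalerDr addn0 addn1.
move: h0 h1 hs; rewrite !ler_norml !ltr_norml => /andP[? ?] /andP[? ?] /andP[? ?].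
by lra.
Qed.

(** All moves of the players of the other parity are undone; their vectors at the
root vanish.  Interlaced leaves with large entries then identify the remaining
combination with the spreading model of the chosen family. *)
Lemma model_le_bounded (b : bool) k (a : 'I_k.+1 -> R) : (forall i, `|a i| <= 1) ->
  comb_norm (e b) a <= comb_norm join_seq a.
Proof.
move=> a1; apply/ler_addgt0Pr => eps eps0.
have e3 : 0 < eps / 3 by rewrite divr_gt0.
have [N hN] := model_gen (hmodel b) e3 a1.
pose c j := a (inord j).
have cE (F : nat -> X) : \sum_(i < k.+1) c i *: F i = \sum_(i < k.+1) a i *: F i.
  by apply: eq_bigr => i _; rewrite /c inord_val.
pose p j := odd j == b.
have dN : depends_on (J k.+1) [set s | `| `|\sum_(i < k.+1) a i *: w i s| - comb_norm join_seq a| < eps / 3].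
  move=> s t st /=; by under eq_bigr => i _ do rewrite (pair_vec_eq_on (ltn_ord i) st).
have aN := V_almostP dN (join_near a e3).
have aM : almost U tree_of (J k.+1) (fun t =>
    `|comb v (fun j => c j./2) xpredT (J k.+1) t| <= comb_norm join_seq a + eps / 3) start.
  apply: almost_mono aN => s _ hs; rewrite comb_J.
  have : `| `|\sum_(i < k.+1) a i *: w i s| - comb_norm join_seq a| < eps / 3 := hs.
  rewrite ltr_norml => /andP[_].
  by rewrite (cE (w^~ s)) ltrBlDl => /ltW.
have aM' := game_mazur UU model_vweak (p := p) (@legal_start tree_of hT _) aM (fun j _ => erefl) e3.
have [s [fs [+ [ls Ns]]]] := almost_ex UU (almost_and UU aM' (almost_interlaced UU Uoo hT _ N)).
rewrite comb_J_parity (cE (fun i => phi b (s (i.*2 + b)%N))) (_ : comb _ _ _ _ _ = 0) ?addr0; last first.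
  by rewrite /comb big1// => j _; rewrite /start /v (model_null (hmodel _)) scaler0.
have memJ' (i : 'I_k.+1) : (i.*2 + b)%N \in [seq j <- J k.+1 | p j].
  by rewrite mem_filter mem_J// /p oddD odd_double oddb eqxx.
have := hN (fun i => s (i.*2 + b)%N) _ _ _.
move=> h1 h2; have {h1} : `| `|\sum_(i < k.+1) a i *: phi b (s (i.*2 + b)%N)| - comb_norm (e b) a| <= eps / 3.
  apply: h1.
  - by move=> i; have := fs _ (memJ' i); rewrite /tree_of oddD odd_double oddb.
  - move=> i j r q ri qj ij; apply: ls => //.
    by move: ij; rewrite /before -!muln2; case: (b) => /=; lia.
  - by move=> i; exact: Ns.
by rewrite ler_norml => /andP[+ _]; lra.
Qed.

End join.

(** * From subordinated weakly null families to trees *)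

(** Both conditions on a plegma tuple are instances of the lexicographic one, and the
second condition yields the comparison of distant entries because enumerations
increase. *)
Lemma plegmaP l (s : 'I_l -> {fset nat}) : plegma s <->
  (forall i, s i != fset0) /\
  forall (i j : 'I_l) p q, (p < size (elems (s i)))%N -> (q < size (elems (s j)))%N ->
    before p i q j -> (nth 0%N (elems (s i)) p < nth 0%N (elems (s j)) q)%N.
Proof.
split=> [[s0 s1 s2]|[s0 h]]; split=> //.
- move=> i j p q; rewrite !size_elems => pi' qj /orP[pq|/andP[/eqP pq ij]]; last first.
    by rewrite -pq; apply: s1; rewrite // leq_min pi' pq.
  apply: (@leq_trans (nth 0%N (elems (s j)) p.+1)).
    by apply: s2; rewrite leq_min pi' /= -ltnS; apply: leq_trans (leqSpred _); exact: leq_ltn_trans pq qj.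
  have [->//|pq'] := eqVneq p.+1 q.
  by apply/ltnW/sorted_ltn_nth; rewrite ?size_elems ?sorted_elems// ltn_neqAle pq'.
- move=> i j k ij; rewrite leq_min -!size_elems => /andP[ki kj].
  by apply: h; rewrite // /before eqxx ij orbT.
- move=> i j k; rewrite leq_min -!size_elems => /andP[ki kj].
  by apply: h; rewrite // ?/before ?ltnSn// ; move: kj; case: (size _).
Qed.

Lemma charf_inj : injective charf.
Proof.
move=> s t /(congr1 (fun c : cantor_space => (c : nat -> bool))) st.
by apply/fsetP => x; have := congr1 (fun c : nat -> bool => c x) st.
Qed.

Lemma tree_long_leaf T N : is_tree T -> exists l, leaf T l /\ all (leq N) l.
Proof.
move=> tT; suff h l : T l -> all (leq N) l -> exists l, leaf T l /\ all (leq N) l.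
  by apply: (h [::]) => //; exact: tree0.
elim/(well_founded_ind (tree_wf tT)): l => l IH Tl lN.
have [ll|nl] := pselect (leaf T l); first by exists l.
pose n := maxn N (\max_(x <- l) x).+1.
have Tn : T (rcons l n).
  apply: tree_nonleaf => //; rewrite sorted_rcons_ltn (tree_sorted tT Tl) /=.
  apply/allP => x xl; rewrite /n leq_max orbC ltnS.
  by rewrite (@leq_bigmax_seq _ _ xpredT id).
apply: (IH (rcons l n)) => //; first by split=> //; exists n.
by rewrite all_rcons lN leq_maxl.
Qed.

(** The ranks r are needed in order to compare T with another family.  At the root phi
vanishes: it is the weak limit of phi along leaves with large entries, where
the family is weakly null. *)
Lemma generated_tree_model (R : realType) (X : completeNormedModType R)
    (A : set {fset nat}) (rho : {fset nat} -> countable_ord) (L : set nat)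
    (x : {fset nat} -> X) (e : hamel_seq R) :
  hereditary A -> spreading A ->
  (forall t, ord_eq (rho t) (OSup [set s | A s /\ (t `<` s)%fset] rho)) ->
  ord_le ord1c (rho fset0) ->
  let F := maximal_elements A in
  infinite_set L -> subordinated F L x -> weakly_null F L x -> generates F L x e ->
  exists T (phi : seq nat -> X) (r : seq nat -> countable_ord),
  [/\ tree_model T phi e, (forall l n, T (rcons l n) -> ord_lt (r (rcons l n)) (r l))
    & r [::] = rho fset0].
Proof.
move=> hA sA rhoE rho1 F Loo [phi cphi phix] wnull [delta [delta0 cdelta gen]].
have [s0 As0 s00] : exists2 s, A s & (fset0 `<` s)%fset.
  have := ord_le_trans rho1 (rhoE fset0).1.
  by move=> /(_ tt I)[s [As s0] _]; exists s.
have A0 : A fset0 by apply: hA As0 _; exact: fsub0set.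
have [m [hm mL tT leafF]] := pullback_tree hA sA A0 rhoE Loo.
pose T := pullback A m; pose g l := fset_of (map m l).
have g0 : g [::] = fset0 by apply/fsetP => y; rewrite mem_fset_of in_fset0.
have gsorted l : sorted ltn l -> sorted ltn (map m l) by rewrite sorted_map_ltn.
have sqg l : T l -> elems (g l) = map m l by move=> [sl _]; rewrite fset_ofK// gsorted.
have gL l : [set` g l] `<=` L.
  by move=> y; rewrite /= mem_fset_of => /mapP[i _ ->]; case: (mL i).
(* The order is at least 1, so that the root has children. *)
have nleaf0 : ~ leaf T [::].
  move=> [_ /(_ (\max_(y <- enum_fset s0) y).+1)]; apply; split=> //.
  rewrite /= (_ : fset_of _ = (m (\max_(y <- enum_fset s0) y).+1 |` fset0)%fset); last first.
    by rewrite -g0 /g -fset_of_rcons.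
  apply: regular_fset1U As0 s00 _ => // y ys.
  apply: leq_trans (strictly_increasing_ge _ hm); rewrite ltnS.
  by rewrite (@leq_bigmax_seq _ _ xpredT id).
have leafx l : leaf T l -> phi (charf (g l)) = x (g l).
  by move=> ll; apply: phix; split=> //; exact: leafF.
have weak l (f : dual X) (eps : R) : T l -> 0 < eps ->
    exists N, forall u, T (l ++ u) -> all (leq N) u ->
      `|sval f (phi (charf (g (l ++ u)))) - sval f (phi (charf (g l)))| < eps.
  move=> Tl eps0.
  have inA u : T u -> (charf @` restr (hat F) L) (charf (g u)).
    by move=> [su Au]; exists (g u) => //; split=> //; exact: regular_hat rhoE _ Au.
  have /subspace_continuousP/(_ _ (inA l Tl)) := cphi.
  move=> /cvg_weak_space/(_ f)/cvgrPdist_lt/(_ _ eps0) near_l.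
  pose G : set_system (seq nat) := [set P | exists N, forall u, all (leq N) u -> P u].
  have FG : Filter G.
    split.
    - by exists 0%N.
    - move=> P Q [N hN] [N' hN']; exists (maxn N N') => u uN; split.
        by apply: hN; apply: sub_all uN => y; apply: leq_trans; exact: leq_maxl.
      by apply: hN'; apply: sub_all uN => y; apply: leq_trans; exact: leq_maxr.
    - by move=> P Q PQ [N hN]; exists N => u /hN/PQ.
  have : charf (g (l ++ u)) @[u --> G] --> charf (g l).
    apply/cvg_cantor => n; exists n.+1 => u un.
    suff : (n \in g (l ++ u)) = (n \in g l) by [].
    rewrite !mem_fset_of map_cat mem_cat orb_idr// => /mapP[i iu nE].
    have := leq_trans (allP un i iu) (strictly_increasing_ge i hm).
    by rewrite -nE ltnn.
  move=> /(_ _ near_l)[N hN]; exists N => u Tu uN.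
  by rewrite distrC; exact: hN uN (inA _ Tu).
have null0 : phi (charf (g [::])) = 0.
  apply: (@weakly_zero _ X) => f; apply/eqP; rewrite -normr_le0.
  apply/ler_addgt0Pr => eps eps0; rewrite add0r.
  have e2 : 0 < eps / 2 by rewrite divr_gt0.
  have [N hN] := weak [::] f _ (tree0 tT) e2.
  have [n0 hn0] := wnull f _ e2.
  have [u [lu uN]] := tree_long_leaf (maxn N n0) tT.
  have h1 : `|sval f (phi (charf (g u))) - sval f (phi (charf (g [::])))| < eps / 2.
    apply: (hN u); first by case: lu.
    by apply: sub_all uN => y; apply: leq_trans; exact: leq_maxl.
  have h2 : `|sval f (x (g u))| < eps / 2.
    apply: hn0; first by split=> //; exact: leafF.
    rewrite fkthE sqg; last by case: lu.
    case: u lu uN {h1} => [/nleaf0//|i u] lu /= /andP[iN _].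
    apply: leq_trans (strictly_increasing_ge i hm); apply: leq_trans iN.
    exact: leq_maxr.
  move: h1 h2; rewrite leafx// distrC => h1 h2.
  rewrite -[sval f _](subrK (sval f (x (g u)))).
  by apply: le_trans (ler_normD _ _) _; lra.
exists T, (fun l => phi (charf (g l))), (fun l => rho (g l)); split; last by rewrite g0.
- split=> // k a eps eps0 a1.
  have /cvgrPdist_lt/(_ _ eps0)[l0 _ hl0] := cdelta.
  (* The number of vectors must not exceed N, and delta N must not exceed eps. *)
pose N := maxn l0 k.+1; exists N => t lt it tN.
  apply: le_trans (_ : delta N <= eps); last first.
    have := hl0 N (leq_maxl _ _); rewrite sub0r normrN.
    by move=> /(le_lt_trans (ler_norm _))/ltW.
  have nz i : t i != [::] by apply/eqP => E; apply: nleaf0; rewrite -E; exact: lt.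
  have Tt i : T (t i) by case: (lt i).
  rewrite (eq_bigr (fun j => a j *: x (g (t j)))); last by move=> i _; rewrite leafx.
  apply: (gen k N a (fun i => g (t i))) => //; first exact: leq_maxr.
  + split; last by move=> i; split=> //; exact: leafF.
    apply/plegmaP; split.
      move=> i; apply/fset0Pn; have := nz i; case E : (t i) => [//|y u] _.
      by exists (m y); rewrite mem_fset_of /= mem_head.
    move=> i j p q; rewrite !sqg// !size_map => pi' qj pq.
    by rewrite !(nth_map 0%N)//; apply: hm; exact: it.
  + rewrite fkthE sqg//; have := nz ord0; have := tN ord0.
    case: (t ord0) => [//|y u] /= /andP[Ny _] _.
    apply: leq_trans (mL y).2; apply: strictly_increasing_le; last by rewrite (leq_trans _ Ny)// leq_pred.
    exact: kth_strictly_increasing.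
- by move=> l n; exact: pullback_rank.
Qed.

(** * Comparing trees with regular families *)

Section embedding.
Variables (A : set {fset nat}) (rho : {fset nat} -> countable_ord).
Hypotheses (hA : hereditary A) (sA : spreading A) (A0 : A fset0).
Hypothesis rhoE : forall t, ord_eq (rho t) (OSup [set s | A s /\ (t `<` s)%fset] rho).

(** As r l is at most the rank of the image s of l, a child of l has rank below that of
s, hence at most that of some proper extension of s in A, and at most that of s
with one large element added.  So a large next value of h keeps the inequality for
all l considered so far. *)
Lemma embed_tree (S : seq nat -> Prop) (r : seq nat -> countable_ord) :
  (forall l, S l -> sorted ltn l) ->
  (forall l n, S (rcons l n) -> S l) ->
  (forall l n, S (rcons l n) -> ord_lt (r (rcons l n)) (r l)) ->
  ord_le (r [::]) (rho fset0) ->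
  exists2 h, strictly_increasing h & forall l, S l -> A (fset_of (map h l)).
Proof.
move=> Ss Sp Sr r0.
pose good (g : nat -> nat) l := A (fset_of (map g l)) /\ ord_le (r l) (rho (fset_of (map g l))).
pose Phi h n := forall l, l \in subseqs (iota 0 (size h)) -> S (rcons l (size h)) ->
  good (nth 0%N h) l ->
  A (n |` fset_of (map (nth 0%N h) l))%fset /\
  ord_le (r (rcons l (size h))) (rho (n |` fset_of (map (nth 0%N h) l))%fset).
have UPhi h : \oo [set n | Phi h n].
  apply: near_all_seq => l _.
  have [[Sl [Al rl]]|nS] := pselect (S (rcons l (size h)) /\ good (nth 0%N h) l); last first.
    by apply: filterS filterT => n _ Sl gl; case: nS.
  have [s [As ls] rs] := ord_lt_le_trans (ord_lt_le_trans (Sr _ _ Sl) rl) (rhoE _).1.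
  apply: filterS (@near_gt_seq \oo _ (fun=> id) (enum_fset s)) => n /allP sn _ _.
  split; first exact: regular_fset1U As ls sn.
  by apply: ord_le_trans rs _; exact: rank_fset1U rhoE _ _ _ As ls sn.
have [f hf fPhi] := @fusion \oo _ (fun=> id) _ UPhi.
exists f => // l Sl; suff: good f l by case.
elim/last_ind: l Sl => [|l i IH] Sl.
  split; rewrite (_ : fset_of _ = fset0)//; apply/fsetP => x; by rewrite mem_fset_of in_fset0.
have Sl' := Sp _ _ Sl; have := Ss _ Sl; rewrite sorted_rcons_ltn => /andP[sl li].
have fE : map (nth 0%N (mkseq f i)) l = map f l.
  by apply/eq_in_map => x /(allP li) xi; rewrite nth_mkseq.
have := fPhi i l; rewrite /good size_mkseq fE map_rcons fset_of_rcons.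
by apply=> //; [apply: mem_subseqs; exact: subseq_iota|exact: IH].
Qed.

Lemma regular_map_le (g h : nat -> nat) l : strictly_increasing g ->
  strictly_increasing h -> (forall i, (g i <= h i)%N) ->
  A (fset_of (map g l)) -> A (fset_of (map h l)).
Proof.
move=> hg hh gh Ag; apply: regular_spread_of Ag _ => //.
pose k y := xget 0%N [set i | h i = y].
have kh i : k (h i) = i.
  by apply: (strictly_increasing_inj hh); apply: (@xgetPex _ 0%N [set j | h j = h i]); exists i.
exists (g \o k); split=> [x y|y]; rewrite !mem_fset_of.
  move=> /mapP[i il ->] /mapP[j jl ->] /=; rewrite !kh.
  by move=> /(strictly_increasing_inj hg) ->.
by move=> /mapP[i il ->] /=; rewrite kh; split=> //; apply/mapP; exists i.
Qed.

End embedding.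

Section cut.
Variable T : seq nat -> Prop.
Hypothesis tT : is_tree T.

Fixpoint cut_from acc l : seq nat :=
  if l is n :: l' then
    if `[< T (rcons acc n) >] then cut_from (rcons acc n) l' else acc
  else acc.

(** The longest prefix in the tree. *)
Definition cut := cut_from [::].

Lemma cutP l : T (cut l) /\ exists r, l = cut l ++ r /\
  forall n r', r = n :: r' -> ~ T (rcons (cut l) n).
Proof.
suff h acc : T acc -> T (cut_from acc l) /\ exists r, acc ++ l = cut_from acc l ++ r /\
    forall n r', r = n :: r' -> ~ T (rcons (cut_from acc l) n).
  exact: (h [::] (tree0 tT)).
elim: l acc => [|n l IH] acc Ta /=; first by split=> //; exists [::].
case: asboolP => Tn; last by split=> //; exists (n :: l); split=> // _ _ [<- _].
by have := IH _ Tn; rewrite cat_rcons.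
Qed.

Lemma cut_size l : (size (cut l) <= size l)%N.
Proof. by have [_ [r [E _]]] := cutP l; rewrite [in leqRHS]E size_cat leq_addr. Qed.

Lemma cut_nth l i : (i < size (cut l))%N -> nth 0%N (cut l) i = nth 0%N l i.
Proof. by move=> il; have [_ [r [E _]]] := cutP l; rewrite [in RHS]E nth_cat il. Qed.

Lemma mem_cut l : {subset cut l <= l}.
Proof. by move=> x xl; have [_ [r [E _]]] := cutP l; rewrite E mem_cat xl. Qed.

(** Hence cutting is continuous: appending large entries to l only changes the result
if l itself lies in the tree. *)
Lemma cut_cat l l' :
  cut (l ++ l') = cut l \/
  cut l = l /\ exists2 v, {subset v <= l'} & cut (l ++ l') = l ++ v.
Proof.
have h acc : cut_from acc (l ++ l') = cut_from acc l \/
    cut_from acc l = acc ++ l /\ cut_from acc (l ++ l') = cut_from (acc ++ l) l'.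
  elim: l acc => [|n l IH] acc /=; first by right; rewrite cats0.
  by case: asboolP => Tn; [rewrite -cat_rcons; exact: IH|left].
case: (h [::]) => /= [|[El E]]; first by left.
right; split=> //; rewrite /cut E.
suff [v vl ->] : exists2 v, {subset v <= l'} & cut_from l l' = l ++ v by exists v.
elim: l' l {h El E} => [|n l' IH] l /=; first by exists [::]; rewrite ?cats0.
case: asboolP => Tn; last by exists [::]; rewrite ?cats0.
have [v vl ->] := IH (rcons l n); exists (n :: v); last by rewrite cat_rcons.
by move=> x; rewrite !in_cons => /orP[->//|/vl ->]; rewrite orbT.
Qed.

End cut.

(** * The sum as a family indexed by a regular thin family *)

Section realization.
Context {R : realType} (X : completeNormedModType R).
Variables (A : set {fset nat}).
Hypotheses (hA : hereditary A).
Let F := maximal_elements A.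
Variables (U : set_system nat).
Hypotheses (UU : UltraFilter U) (Uoo : \oo `<=` U).
Variables (T : bool -> seq nat -> Prop) (phi : bool -> seq nat -> X).
Variables (e : bool -> hamel_seq R).
Hypothesis hmodel : forall b, tree_model (T b) (phi b) (e b).
Variables (V : set_system state) (VU : UltraFilter V)
  (V_almost : eventually_almost U T `<=` V).
Let E := join_seq UU Uoo hmodel VU V_almost.

Variables (f : nat -> nat) (h : nat -> nat).
Hypotheses (hf : strictly_increasing f) (hh : strictly_increasing h).
Hypothesis fclose : forall k l t, (k <= l.+1)%N ->
  final (fun j => T (odd j)) (iota 0 k.*2) t -> interlaced (iota 0 k.*2) t ->
  {in iota 0 k.*2, forall j x, x \in t j -> exists2 i, (l <= i)%N & x = f i} ->
  close_to_join UU Uoo hmodel VU V_almost k l t.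
Let p (b : bool) i := f (i.*2 + b).
Hypothesis hemb : forall b l, T b (map (p b) l) -> A (fset_of (map h l)).

Let p_lt (b c : bool) i j : (i < j)%N -> (p b i < p c j)%N.
Proof. by move=> ij; apply: hf; rewrite -!muln2; case: b; case: c => /=; lia. Qed.

Let hp b : strictly_increasing (p b).
Proof. by move=> i j; exact: p_lt. Qed.

Let k y := xget 0%N [set i | h i = y].

Let kh i : k (h i) = i.
Proof.
by apply: (strictly_increasing_inj hh); apply: (@xgetPex _ 0%N [set j | h j = h i]); exists i.
Qed.

Let hk y : range h y -> h (k y) = y.
Proof. by move=> [i _ <-]; rewrite kh. Qed.

Definition code (s : {fset nat}) : seq nat := map k (elems s).

Let map_code s : [set` s] `<=` range h -> map h (code s) = elems s.
Proof.
move=> sL; rewrite /code -map_comp -[RHS]map_id; apply/eq_in_map => y ys /=.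
by rewrite hk//; apply: sL; rewrite /= -mem_elems.
Qed.

Let sorted_code s : [set` s] `<=` range h -> sorted ltn (code s).
Proof. by move=> sL; rewrite -(sorted_map_ltn _ hh) map_code// sorted_elems. Qed.

(** The two components of the index s: the branches of the two trees along the code
of s, over even and over odd terms of f, up to the point where they leave the tree. *)
Definition part b s : seq nat := cut (T b) (map (p b) (code s)).

Definition sum_seq s : X := phi false (part false s) + phi true (part true s).

Let hT b : is_tree (T b) := model_tree (hmodel b).

Lemma part_mem b s y : y \in part b s -> exists2 i, i \in code s & y = p b i.
Proof. by move=> /(mem_cut (hT b))/mapP[i ic ->]; exists i. Qed.

(** If the branch of s did not reach a leaf, it would be exhausted inside the tree and
could be extended there, whence s would have a proper extension in A. *)
Lemma part_leaf b s : restr F (range h) s -> leaf (T b) (part b s).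
Proof.
move=> [[As smax] sL]; apply: contrapT => nl.
have [Tu [r [lE rstop]]] := cutP (hT b) (map (p b) (code s)).
have sc : sorted ltn (map (p b) (code s)) by rewrite sorted_map_ltn// sorted_code.
case: r lE rstop => [|n r] lE rstop; last first.
  apply: (rstop n r erefl); apply: (tree_nonleaf (hT b) Tu nl).
  by move: sc; rewrite {1}lE -cat_rcons => /cat_sorted2[].
pose i := (\max_(y <- code s) y).+1.
have ci y : y \in code s -> (y < i)%N.
  by move=> yc; rewrite ltnS (@leq_bigmax_seq _ _ xpredT id).
have Ti : T b (rcons (part b s) (p b i)).
  apply: (tree_nonleaf (hT b) Tu nl); rewrite sorted_rcons_ltn (tree_sorted (hT b) Tu) /=.
  by apply/allP => y /part_mem[j /ci ji ->]; exact: hp.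
have := hemb (b := b) (l := rcons (code s) i); rewrite map_rcons lE cats0 => /(_ Ti).
rewrite map_rcons map_code// fset_of_rcons elemsK => Ai.
have := smax _ Ai (fsubsetU1 _ _) => /fsetP/(_ (h i)); rewrite fset1U1 => /esym.
rewrite -mem_elems -map_code// => /mapP[j /ci ji /(strictly_increasing_inj hh) ij].
by rewrite ij ltnn in ji.
Qed.

(** The components of a plegma tuple of members of F are interlaced leaves with entries
in the range of f, because f separates the even from the odd terms of index i and
both from those of index i + 1. *)
Lemma sum_seq_generates : generates F (range h) sum_seq E.
Proof.
(* The bound available is 1 / l, for l >= 1; this majorant is positive at 0 too. *)
exists (fun n => 2 * n.+1%:R^-1); split=> [n||n l a s nl a1 [[s0 s1 s2] sF] sl].
- by rewrite mulr_gt0// invr_gt0.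
- rewrite -[X in _ --> X](mulr0 2); apply: cvgMl_tmp; exact: cvg_harmonic.
have /plegmaP[_ spl] : plegma s by [].
have sL i : [set` s i] `<=` range h by case: (sF i).
have szc i : size (code (s i)) = size (elems (s i)) by rewrite size_map.
have codelt i j q r : (q < size (code (s i)))%N -> (r < size (code (s j)))%N ->
    before q i r j -> (nth 0 (code (s i)) q < nth 0 (code (s j)) r)%N.
  move=> qi rj qr; rewrite -(strictly_increasing_ltP _ _ hh).
  rewrite -!(nth_map 0%N 0%N h)// !map_code//.
  by apply: spl; rewrite -?szc.
have lc i y : y \in code (s i) -> (l.-1 <= y)%N.
  move=> /(nthP 0%N)[q qi <-].
  have h0 : (0 < size (code (s ord0)))%N.
    by rewrite szc size_elems cardfs_gt0.
  have l0 : (l.-1 <= nth 0%N (code (s ord0)) 0)%N.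
    rewrite leqNgt; apply/negP => /hh; apply/negP; rewrite -leqNgt.
    rewrite -(nth_map 0%N 0%N h)// map_code//; apply: leq_trans sl.
    exact: kth_range_ge.
  apply: leq_trans l0 _; have [|] := boolP (before 0 (@ord0 n) q i).
    by move=> b0; apply/ltnW/codelt.
  rewrite /before negb_or -leqNgt leqn0 => /andP[/eqP ->]; rewrite eqxx /= -leqNgt leqn0.
  by move=> /eqP i0; rewrite (_ : i = ord0)//; exact: val_inj.
pose t : state := fun j => part (odd j) (s (inord j./2)).
have ht j : j \in iota 0 n.+1.*2 -> (j./2 < n.+1)%N.
  by rewrite mem_iota leq0n add0n -[j in (j < _)%N]odd_double_half -!muln2 /=; case: (odd j) => /=; lia.
have := fclose (k := n.+1) (l := l.-1) (t := t) _ _ _ _ a1.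
have -> : \sum_(i < n.+1) a i *: pair_vec phi i t = \sum_(j < n.+1) a j *: sum_seq (s j).
  apply: eq_bigr => i _; rewrite /pair_vec /t /sum_seq odd_double doubleK /=.
  by rewrite odd_double uphalf_double inord_val.
move=> H; apply: le_trans (H _ _ _ _) _.
- by rewrite (ltn_predK nl).
- by move=> j _; exact: part_leaf.
- move=> i j q r iJ jJ qi rj qr; rewrite /t !cut_nth//.
  have {}qi := leq_trans qi (cut_size (hT _) _).
  have {}rj := leq_trans rj (cut_size (hT _) _).
  rewrite !size_map -!szc in qi rj *.
  rewrite (nth_map 0%N 0%N (p (odd i)) qi) (nth_map 0%N 0%N (p (odd j)) rj).
  have [b|nb] := boolP (before q (inord i./2 : 'I_n.+1) r (inord j./2 : 'I_n.+1)).
    by apply: p_lt; exact: codelt.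
  move: qr nb; rewrite /before !inordK ?ht// => qr nb.
  (* The remaining case: the two components of the same member, at the same index. *)
have [qE [ijE [io jo]]] : q = r /\ i./2 = j./2 /\ odd i = false /\ odd j = true.
    move: qr nb; rewrite -{1}(odd_double_half i) -{1}(odd_double_half j) -!muln2.
    by case: (odd i); case: (odd j) => /=; lia.
  by rewrite qE ijE io jo /p; apply: hf; rewrite addn0 addn1.
- move=> j jJ y /part_mem[i ic ->]; exists (i.*2 + odd j)%N => //.
  by apply: leq_trans (lc _ _ ic) _; rewrite -addnn -addnA leq_addr.
rewrite (ltn_predK nl) ler_pdivlMr// mulrC ler_pdivrMr ?ltr0n ?(leq_trans _ nl)//.
by rewrite -natrM ler_nat; lia.
Qed.

Let weak_part b s (g : dual X) (eps : R) : A s -> [set` s] `<=` range h -> 0 < eps ->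
  exists N, forall s', [set` s'] `<=` range h ->
    (forall y, (y < N)%N -> (y \in s') = (y \in s)) ->
    `|sval g (phi b (part b s')) - sval g (phi b (part b s))| < eps.
Proof.
move=> As sL eps0.
have [Tu _] := cutP (hT b) (map (p b) (code s)).
have [N0 hN0] := model_weak (hmodel b) g Tu eps0.
(* Agreement below N makes s an initial segment of s'; the further elements
   have codes at least N0. *)
pose N := maxn (h N0) (\max_(y <- elems s) y).+1.
exists N => s' s'L ss'.
have sN y : y \in s -> (y < N)%N.
  by rewrite -mem_elems => ys; rewrite leq_max orbC ltnS (@leq_bigmax_seq _ _ xpredT id).
have [r sE rN] : exists2 r, elems s' = elems s ++ r & all (leq N) r.
  exists [seq y <- elems s' | (N <= y)%N]; last exact: filter_all.
  apply: sorted_ltn_inj; first exact: sorted_elems.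
    rewrite (sorted_pairwise ltn_trans) pairwise_cat -!(sorted_pairwise ltn_trans).
    rewrite sorted_elems (sorted_filter ltn_trans) ?sorted_elems// !andbT.
    apply/allrelP => y z; rewrite mem_elems mem_filter => /sN yN /andP[Nz _].
    exact: leq_trans Nz.
  move=> y; rewrite mem_cat mem_filter !mem_elems.
  have [Ny|yN] := leqP N y; last by rewrite orbF ss'.
  by rewrite [y \in s](_ : _ = false)//; apply/negP => /sN; rewrite ltnNge Ny.
have cE : code s' = code s ++ map k r by rewrite /code sE map_cat.
have kr y : y \in map (p b) (map k r) -> (N0 <= y)%N.
  move=> /mapP[_ /mapP[z zr ->] ->]; apply: leq_trans (strictly_increasing_ge _ (hp b)).
  have zL : range h z.
    by apply: s'L; rewrite /= -mem_elems sE mem_cat zr orbT.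
  rewrite leqNgt -(strictly_increasing_ltP _ _ hh) hk// -leqNgt.
  by apply: leq_trans (allP rN z zr); exact: leq_maxl.
rewrite /part cE map_cat.
have [Ec|[Ec [v vr Ev]]] := cut_cat (T b) (map (p b) (code s)) (map (p b) (map k r)).
  by rewrite Ec subrr normr0.
rewrite Ev Ec; rewrite Ec in hN0; apply: hN0; last by apply/allP => y /vr/kr.
by rewrite -Ev; case: (cutP (hT b) (map (p b) (code s) ++ map (p b) (map k r))).
Qed.

Lemma sum_seq_subordinated : subordinated F (range h) sum_seq.
Proof.
pose dec (c : cantor_space) := xget fset0 [set s | charf s = c].
have decK s : dec (charf s) = s.
  by apply: charf_inj; apply: (@xgetPex _ fset0 [set t | charf t = charf s]); exists s.
exists (fun c => sum_seq (dec c)); last by move=> s _; rewrite decK.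
apply/subspace_continuousP => _ [s [[u [Au _] su] sL] <-].
have As : A s := hA Au su.
apply/cvg_weak_space => g; apply/cvgrPdist_lt => eps eps0.
suff H : within (charf @` restr (hat F) (range h)) (nbhs (charf s)) [set c |
    `|sval g (sum_seq (dec (charf s))) - sval g (sum_seq (dec c))| < eps] by exact: H.
rewrite decK.
have e2 : 0 < eps / 2 by rewrite divr_gt0.
have [N0 h0] := weak_part false g As sL e2.
have [N1 h1] := weak_part true g As sL e2.
have cyl : nbhs (charf s) [set d | forall n, n \in iota 0 (maxn N0 N1) -> d n = charf s n].
  apply: near_all_seq => n _.
  exact: ((cvg_cantor (charf s) (nbhs_filter (charf s))).1 cvg_id n).
rewrite /within /=; apply: filterS cyl => d hd [s' [_ s'L] dE].
have agree M : (M <= maxn N0 N1)%N -> forall y, (y < M)%N -> (y \in s') = (y \in s).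
  move=> MN y yM; have := hd y; rewrite mem_iota leq0n add0n => /(_ (leq_trans yM MN)).
  by rewrite -dE.
have := h0 s' s'L (agree _ (leq_maxl _ _)); have := h1 s' s'L (agree _ (leq_maxr _ _)).
move=> H1 H0.
suff : `|sval g (sum_seq s) - sval g (sum_seq (dec d))| < eps by [].
rewrite -dE decK /sum_seq !(linearD (sval g)) distrC opprD addrACA.
by apply: le_lt_trans (ler_normD _ _) _; lra.
Qed.

Lemma sum_seq_weakly_null : weakly_null F (range h) sum_seq.
Proof.
move=> g eps eps0.
have e2 : 0 < eps / 2 by rewrite divr_gt0.
have small b : exists N, forall s, restr F (range h) s -> (h N <= fkth s 0)%N ->
    `|sval g (phi b (part b s))| < eps / 2.
  have [N hN] := model_weak (hmodel b) g (tree0 (hT b)) e2.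
  exists N => s sF sN; have := hN (part b s); rewrite /= (model_null (hmodel b)) linear0 subr0.
  apply; first by case: (part_leaf b sF).
  apply/allP => y /part_mem[i ic ->]; apply: leq_trans (strictly_increasing_ge _ (hp b)).
  have sL : [set` s] `<=` range h by case: sF.
  rewrite leqNgt; apply/negP => /hh; apply/negP; rewrite -leqNgt; apply: leq_trans sN _.
  have : h i \in elems s by rewrite -map_code// map_f.
  rewrite fkthE => /(nthP 0%N)[[|q] qs <-//].
  by apply/ltnW/sorted_ltn_nth => //; exact: sorted_elems.
have [N0 h0] := small false; have [N1 h1] := small true.
exists (h (maxn N0 N1)) => s sF sN; rewrite /sum_seq (linearD (sval g)).
have H0 := h0 s sF (leq_trans (strictly_increasing_le hh (leq_maxl N0 N1)) sN).
have H1 := h1 s sF (leq_trans (strictly_increasing_le hh (leq_maxr N0 N1)) sN).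
by apply: le_lt_trans (ler_normD _ _) _; lra.
Qed.

End realization.

(** * Joins of spreading models *)

(** The generating condition controls coefficients in the unit cube only. *)
Lemma le_of_unit_ball (R : realType) n (f g : ('I_n -> R) -> R) :
  (forall c a, 0 < c -> f (fun i => c * a i) = c * f a) ->
  (forall c a, 0 < c -> g (fun i => c * a i) = c * g a) ->
  (forall a, (forall i, `|a i| <= 1) -> f a <= g a) -> forall a, f a <= g a.
Proof.
move=> fZ gZ fg a; pose c := 1 + \sum_i `|a i|.
have c0 : 0 < c by rewrite ltr_wpDr// sumr_ge0.
have -> : a = fun i => c * (a i / c).
  by apply/funext => i; rewrite mulrC divfK// gt_eqF.
rewrite fZ// gZ// ler_pM2l//; apply: fg => i.
rewrite normrM normfV (gtr0_norm c0) ler_pdivrMr// mul1r /c (bigD1 i)//=.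
by rewrite addrCA lerDl addr_ge0// sumr_ge0.
Qed.

Section join_of_spreading_models.
Context {R : realType} (X : completeNormedModType R).
Variable xi : countable_ord.
Hypothesis xi1 : ord_le ord1c xi.

(** The sum is indexed by the first family.  The second one enters through its tree
only, and this is where the equality of the orders is used: ranks in either tree
start below the rank of the first family. *)
Lemma SMw_sum (e0 e1 : hamel_seq R) : SMw X xi e0 -> SMw X xi e1 ->
  exists e, [/\ SMw X xi e,
    forall n (a : 'I_n -> R), comb_norm e0 a <= comb_norm e a,
    forall n (a : 'I_n -> R), comb_norm e1 a <= comb_norm e a
    & forall n (a : 'I_n -> R), comb_norm e a <= comb_norm e0 a + comb_norm e1 a].
Proof.
move=> [F0 [L0 [x0 [[A0 [rA0 F0E [rho0 rho0E rho0x]]] L0oo sub0 wn0 gen0]]]].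
move=> [F1 [L1 [x1 [[A1 [rA1 F1E [rho1 rho1E rho1x]]] L1oo sub1 wn1 gen1]]]].
have [_ hA0 sA0] := rA0; have [_ hA1 sA1] := rA1.
have one0 : ord_le ord1c (rho0 fset0) by apply: ord_le_trans xi1 rho0x.2.
have one1 : ord_le ord1c (rho1 fset0) by apply: ord_le_trans xi1 rho1x.2.
have Aempty : A0 fset0.
  have := ord_le_trans one0 (rho0E fset0).1 => /(_ tt I)[s [As _] _].
  by apply: hA0 As _; exact: fsub0set.
subst F0 F1.
have [T0 [phi0 [r0 [model0 r0lt r0E]]]] := generated_tree_model hA0 sA0 rho0E one0 L0oo sub0 wn0 gen0.
have [T1 [phi1 [r1 [model1 r1lt r1E]]]] := generated_tree_model hA1 sA1 rho1E one1 L1oo sub1 wn1 gen1.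
pose T b := if b then T1 else T0; pose phi b := if b then phi1 else phi0.
pose e b := if b then e1 else e0; pose r b := if b then r1 else r0.
have hmodel b : tree_model (T b) (phi b) (e b) by case: b.
have rlt b l n : T b (rcons l n) -> ord_lt (r b (rcons l n)) (r b l).
  by case: b; [exact: r1lt|exact: r0lt].
have r0le b : ord_le (r b [::]) (rho0 fset0).
  case: b; rewrite /r ?r0E ?r1E; last exact: ord_le_refl.
  exact: ord_le_trans rho1x.1 rho0x.2.
have [U [UU Uoo]] := ultraFilterLemma eventually_filter.
have [V [VU V_almost]] := ultraFilterLemma (eventually_almost_filter UU Uoo hmodel).
have [f hf fclose] := join_fusion UU Uoo hmodel VU V_almost.
pose p (b : bool) i := f (i.*2 + b)%N.
have hp b : strictly_increasing (p b).
  by move=> i j ij; apply: hf; rewrite ltn_add2r ltn_double.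
have emb b : exists2 h, strictly_increasing h &
    forall l, T b (map (p b) l) -> A0 (fset_of (map h l)).
  have tT := model_tree (hmodel b).
  apply: (embed_tree hA0 sA0 Aempty rho0E (r := fun l => r b (map (p b) l))).
  - by move=> l /(tree_sorted tT); rewrite sorted_map_ltn.
  - by move=> l n; rewrite map_rcons => /(tree_prefix tT).
  - by move=> l n; rewrite map_rcons; exact: rlt.
  - exact: r0le.
have [g0 hg0 gA0] := emb false; have [g1 hg1 gA1] := emb true.
(* Moving the elements to the right stays in A0, so one map serves both trees. *)
pose h i := maxn (g0 i) (g1 i).
have hh : strictly_increasing h.
  move=> i j ij; rewrite /h gtn_max !leq_max hg0//= orbC hg1//.
have hemb b l : T b (map (p b) l) -> A0 (fset_of (map h l)).
  case: b => [/gA1|/gA0]; apply: regular_map_le => // i.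
    exact: leq_maxr.
  exact: leq_maxl.
pose E := join_seq UU Uoo hmodel VU V_almost.
have scale (c : hamel_seq R) n (t : R) (a : 'I_n -> R) : 0 < t ->
    comb_norm c (fun i => t * a i) = t * comb_norm c a.
  by move=> t0; rewrite comb_normZ gtr0_norm.
have le_e b n (a : 'I_n -> R) : comb_norm (e b) a <= comb_norm E a.
  case: n a => [|n] a; first by rewrite !comb_norm0.
  apply: le_of_unit_ball a => [t a t0|t a t0|]; [exact: scale|exact: scale|].
  exact: model_le_bounded.
exists E; split; [|exact: (le_e false)|exact: (le_e true)|].
  exists (maximal_elements A0), (range h), (sum_seq T phi f h); split.
  - by exists A0; split=> //; exists rho0.
  - exact: infinite_range.
  - exact: (sum_seq_subordinated hA0 hmodel hf hh).
  - exact: (sum_seq_weakly_null hmodel hf hh hemb).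
  - exact: sum_seq_generates hf hh fclose hemb.
move=> [|n] a; first by rewrite !comb_norm0 addr0.
apply: (@le_of_unit_ball R n.+1 (@comb_norm R E n.+1)
  (fun a => comb_norm e0 a + comb_norm e1 a) _ _ _ a) => [t b t0|t b t0|].
- exact: scale.
- by rewrite !scale// mulrDr.
- exact: join_le_bounded.
Qed.

End join_of_spreading_models.

Lemma dominated_refl (R : realType) (e : hamel_seq R) : dominated e e.
Proof. by exists 1 => // n a; rewrite mul1r. Qed.

Lemma dominated_trans (R : realType) (e1 e2 e3 : hamel_seq R) :
  dominated e1 e2 -> dominated e2 e3 -> dominated e1 e3.
Proof.
move=> [C C0 h] [D D0 k]; exists (C * D); first exact: mulr_gt0.
by move=> n a; apply: le_trans (h n a) _; rewrite -mulrA ler_wpM2l// ltW.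
Qed.

Section quotient.
Context {R : realType} (X : completeNormedModType R) (xi : countable_ord).
Let cls (e : hamel_seq R) (e' : hamel_seq R) : Prop := SMw X xi e' /\ seq_equiv e e'.

Lemma class_leP (e f : hamel_seq R) : SMw X xi e -> SMw X xi f ->
  class_le (cls e) (cls f) <-> dominated e f.
Proof.
move=> Se Sf; split.
  move=> [e' [f' [[_ [ee' _]] [_ [_ f'f]] ef]]].
  exact: dominated_trans ee' (dominated_trans ef f'f).
move=> ef; exists e, f; split=> //; do !split=> //; exact: dominated_refl.
Qed.

Lemma class_eq (e f : hamel_seq R) : dominated e f -> dominated f e -> cls e = cls f.
Proof.
move=> ef fe; apply/funext => g; apply/propext; split=> -[Sg [h1 h2]]; split=> //.
  by split; [exact: dominated_trans fe h1|exact: dominated_trans h2 ef].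
by split; [exact: dominated_trans ef h1|exact: dominated_trans h2 fe].
Qed.

End quotient.

Theorem theorem18 (R : realType) (X : completeNormedModType R)
    (xi : countable_ord) (xi_ge1 : ord_le ord1c xi) :
  upper_semilattice (SMw_classes X xi) (@class_le R).
Proof.
split; first split.
- by move=> _ [e Se ->]; apply/class_leP => //; exact: dominated_refl.
- move=> _ _ [e Se ->] [f Sf ->] /(class_leP Se Sf) ef /(class_leP Sf Se) fe.
  exact: class_eq.
- move=> _ _ _ [e Se ->] [f Sf ->] [g Sg ->] /(class_leP Se Sf) ef /(class_leP Sf Sg) fg.
  by apply/(class_leP Se Sg); exact: dominated_trans ef fg.
move=> _ _ [e Se ->] [f Sf ->].
have [g [Sg eg fg gef]] := SMw_sum xi_ge1 Se Sf.
exists (fun e' => SMw X xi e' /\ seq_equiv g e'); split.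
- by exists g.
- by apply/(class_leP Se Sg); exists 1 => // n a; rewrite mul1r.
- by apply/(class_leP Sf Sg); exists 1 => // n a; rewrite mul1r.
- move=> _ [d Sd ->] /(class_leP Se Sd)[C C0 ed] /(class_leP Sf Sd)[D D0 fd].
  apply/(class_leP Sg Sd); exists (C + D); first exact: addr_gt0.
  by move=> n a; apply: le_trans (gef n a) _; rewrite mulrDl lerD.
Qed.
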